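(* Let $z,s,a\in\mathbb{C}$ with $0<|z|<1$ and $a\notin\{0,-1,-2,\dots\}$, and let $N\ge 0$ and $M\ge 1$ be integers with $\Re(a)+N>0$. Then $$\Phi(z,s,a)=S+I+T+R,$$ where $$S=\sum_{k=0}^{N-1}\frac{z^k}{(k+a)^s},$$ $$I=\frac{(-\log z)^{s-1}}{z^a}\,\Gamma\bigl(1-s,-(a+N)\log z\bigr),$$ $$T=\frac{z^N}{(a+N)^s}\left(\frac12+\sum_{k=1}^{M}\frac{B_{2k}}{(2k)!}\,\frac{U\bigl(-2k+1,\,-2k+2-s,\,-(a+N)\log z\bigr)}{(a+N)^{2k-1}}\right),$$ $$R=-\int_N^\infty \frac{\tilde B_{2M}(t)}{(2M)!}\,\frac{z^t}{(a+t)^{s+2M}}\,U\bigl(-2M,\,-2M+1-s,\,-(a+t)\log z\bigr)\,dt.$$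
   Context: The Lerch transcendent is $\Phi(z,s,a)=\sum_{k=0}^\infty \frac{z^k}{(k+a)^s}$ for $|z|<1$ and $a\notin\{0,-1,-2,\dots\}$. Here $\log$ and all complex powers take principal values, with $z^t=e^{t\log z}$. $\Gamma(\alpha,x)$ is the upper incomplete Gamma function (principal branch). $U(\alpha,\beta,x)$ is the Tricomi confluent hypergeometric function; for a nonnegative integer $n$, $U(-n,1-n-s,x)$ is the polynomial $\sum_{j=0}^{n}\binom{n}{j}(s)_j\,x^{n-j}$, where $(s)_j=s(s+1)\cdots(s+j-1)$. $B_n$ is the $n$-th Bernoulli number, $B_n(x)$ the $n$-th Bernoulli polynomial, and $\tilde B_n(t)=B_n(t-\lfloor t\rfloor)$ the periodic Bernoulli function. *)

(* Defs.v *)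
From Stdlib Require Import Reals.
From Coquelicot Require Import Coquelicot.

Local Open Scope R_scope.

(** Complex exponential, principal argument (in ]-PI, PI]), logarithm, power.
    The values at 0 are meaningless. *)

Definition Cexp (w : C) : C :=
  (exp (Re w) * cos (Im w), exp (Re w) * sin (Im w)).

Definition Carg (w : C) : R :=
  if Rlt_dec (Im w) 0 then - acos (Re w / Cmod w) else acos (Re w / Cmod w).

Definition Clog (w : C) : C := (ln (Cmod w), Carg w).

Definition Cpower (w t : C) : C := Cexp (t * Clog w)%C.

Definition sum_lt (f : nat -> C) : nat -> C :=
  fix sum n := match n with O => RtoC 0 | S m => (sum m + f m)%C end.

(** Meaningful when the series converges, in particular for [Cmod z < 1]. *)
Definition lerch_phi (z s a : C) : C :=
  @iota C_R_CompleteNormedModule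
    (is_series (V := C_R_NormedModule)
       (fun k : nat => (z ^ k / Cpower (RtoC (INR k) + a) s)%C)).

(** The principal branch is the integral of [v^(alpha-1) e^(-v)] from [x] to
    [+oo] along any path avoiding the cut ]-oo, 0].  The path here is the
    horizontal ray [v = x + u], [u >= 0], which avoids the cut exactly when
    [x] is not on it. *)
Definition Gamma_upper (alpha x : C) : C :=
  RInt_gen (V := C_R_CompleteNormedModule)
    (fun u : R =>
       (Cpower (x + RtoC u) (alpha - 1) * Cexp (- (x + RtoC u)))%C)
    (at_point 0) (Rbar_locally p_infty).

Fixpoint pochhammer (s : C) (j : nat) : C :=
  match j with
  | O => RtoC 1
  | S i => (pochhammer s i * (s + RtoC (INR i)))%C
  end.

(** [tricomiU_neg n beta x] is U(-n, beta, x), a polynomial in [x]; it is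
    given by sum_j binom(n,j) (s)_j x^(n-j) where [s] is determined by
    beta = 1 - n - s. *)
Definition tricomiU_neg (n : nat) (beta x : C) : C :=
  let s := (1 - RtoC (INR n) - beta)%C in
  sum_lt (fun j : nat =>
    (RtoC (Binomial.C n j) * pochhammer s j * x ^ (n - j))%C) (S n).

(** [bernoulli_upto n k] is B_k for [k <= n], using
    sum_(j <= m+1) binom(m+2,j) B_j = 0 (so B_1 = -1/2). *)
Fixpoint bernoulli_upto (n : nat) : nat -> R :=
  match n with
  | O => fun _ => 1
  | S m =>
      let B := bernoulli_upto m in
      fun k =>
        if Nat.leb k m then B k
        else - / INR (m + 2) *
             sum_f_R0 (fun j => Binomial.C (m + 2) j * B j) m
  end.

Definition bernoulli (n : nat) : R := bernoulli_upto n n.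

Definition bernoulli_poly (n : nat) (x : R) : R :=
  sum_f_R0 (fun j => Binomial.C n j * bernoulli j * x ^ (n - j)) n.

Definition periodic_bernoulli (n : nat) (t : R) : R :=
  bernoulli_poly n (frac_part t).

(* Main.v *)
Require Import Defs.
From Stdlib Require Import Reals Factorial Lra Lia.
From Coquelicot Require Import Coquelicot.

(** Apply the Euler-Maclaurin formula on [N, +oo[ to
    [f t = z^t / (a + t)^s = z^(-a) w^(-s) e^(-L w)], where [w = a + t] and
    [L = - log z], [Re L > 0].  Its [n]-th derivative is
    [(-1)^n z^t (a + t)^(-s-n) U(-n, 1-n-s, L w)], so the boundary terms give T and
    the remainder gives R; exponential decay makes every boundary term at infinity vanish.
    In [int_N^oo f] both [L] and [w] lie in the right half plane, where the principal
    logarithm satisfies [log (L w) = log L + log w]; hence the horizontal ray defining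
    the incomplete Gamma function becomes, in the variable [w], the ray from [a + N] in the
    direction [1 / L], and it can be rotated to the direction [1] inside the half plane. *)

Local Open Scope R_scope.

(** * Complex exponential and principal logarithm *)

(** The analysis is real throughout: [C] is a real normed space of dimension two, functions of a
    complex variable are differentiated only along curves [w : R -> C], and the contour argument is
    a homotopy differentiated under the integral sign. The obstacle is the branch of [Clog], whose
    smoothness is established only on [0 < Re w]; every path is therefore kept in that half plane.
    The terms with [k < N], where [k + a] may lie outside it, are copied into S untouched.

    The scheme closes because the family [powexp L s], with [s] varying, is stable under
    differentiation: a factor [1 / w] turns [s] into [s + 1]. The Tricomi polynomials obey the same
    recursion up to signs and powers of [w]. All derivatives share the rate of decay [Re L / 2]:
    half of the exponential is spent on absorbing [w^(-s)], which may grow or decay.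

    Convergence of the Lerch series is not proved beforehand: the finite formula on [N, N + n] gives
    the partial sums, and the limit in [n] yields both convergence and the value. *)

Lemma C_ext (x y : C) : Re x = Re y -> Im x = Im y -> x = y.
Proof. destruct x, y; simpl; intros; subst; reflexivity. Qed.

Lemma Cexp_plus (x y : C) : Cexp (x + y) = (Cexp x * Cexp y)%C.
Proof.
  destruct x as [x1 x2], y as [y1 y2]; unfold Cexp; simpl.
  rewrite exp_plus, cos_plus, sin_plus.
  apply C_ext; simpl; ring.
Qed.

Lemma Cexp_0 : Cexp 0 = RtoC 1.
Proof. unfold Cexp; simpl; rewrite exp_0, cos_0, sin_0; apply C_ext; simpl; ring. Qed.

Lemma Cmod_Cexp (x : C) : Cmod (Cexp x) = exp (Re x).
Proof.
  unfold Cmod, Cexp; simpl fst; simpl snd.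
  replace (_ + _) with ((exp (Re x)) ^ 2 * ((sin (Im x))² + (cos (Im x))²))
    by (unfold Rsqr; ring).
  rewrite sin2_cos2, Rmult_1_r, sqrt_pow2; auto.
  apply Rlt_le, exp_pos.
Qed.

Lemma Cexp_neq_0 (x : C) : Cexp x <> RtoC 0.
Proof. apply Cmod_gt_0; rewrite Cmod_Cexp; apply exp_pos. Qed.

Lemma Cexp_opp (x : C) : Cexp (- x) = (/ Cexp x)%C.
Proof.
  assert (H : (Cexp (- x) * Cexp x = 1)%C).
  { rewrite <- Cexp_plus, Cplus_comm, Cplus_opp_r; apply Cexp_0. }
  assert (H0 := Cexp_neq_0 x).
  replace (Cexp (- x)) with (Cexp (- x) * Cexp x / Cexp x)%C by (field; auto).
  rewrite H; field; auto.
Qed.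

Lemma Cexp_mult_nat (x : C) (n : nat) : Cexp (RtoC (INR n) * x) = (Cexp x ^ n)%C.
Proof.
  induction n.
  - simpl; rewrite Cmult_0_l; apply Cexp_0.
  - rewrite S_INR, RtoC_plus, Cpow_S, <- IHn, <- Cexp_plus; f_equal; ring.
Qed.

(** Comparing moduli settles the real parts. The distance [d] of the imaginary parts then has cosine
    1; if [0 < d < 2 * PI], then [sin (d / 2) > 0], so [cos d = 1 - 2 sin^2 (d / 2) < 1]. *)
Lemma Cexp_inj (p q : C) : Rabs (Im p - Im q) < 2 * PI -> Cexp p = Cexp q -> p = q.
Proof.
  intros Hi H.
  assert (Hr : Re p = Re q).
  { apply exp_inv; rewrite <- !Cmod_Cexp, H; reflexivity. }
  apply C_ext; auto.
  assert (H1 : Cexp (p - q) = RtoC 1).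
  { unfold Cminus; rewrite Cexp_plus, Cexp_opp, H; field; apply Cexp_neq_0. }
  assert (Hc := f_equal fst H1); assert (Hs := f_equal snd H1).
  destruct p as [p1 p2], q as [q1 q2]; unfold Cexp in Hc, Hs; simpl in *; subst.
  replace (q1 + - q1) with 0 in * by ring; rewrite exp_0, Rmult_1_l in Hc, Hs.
  change (p2 + - q2) with (p2 - q2) in *.
  destruct (Req_dec (p2 - q2) 0) as [|Hd]; [lra|exfalso].
  assert (Ha : 0 < Rabs (p2 - q2)) by (apply Rabs_pos_lt; auto).
  assert (Hc' : cos (Rabs (p2 - q2)) = 1).
  { unfold Rabs; destruct (Rcase_abs _); rewrite ?cos_neg; auto. }
  set (d := Rabs (p2 - q2)) in *.
  assert (Hh : 0 < sin (d / 2)) by (apply sin_gt_0; lra).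
  replace d with (2 * (d / 2)) in Hc' by field.
  rewrite cos_2a_sin in Hc'; nra.
Qed.

Lemma Re_div_Cmod_bound (w : C) : w <> RtoC 0 -> -1 <= Re w / Cmod w <= 1.
Proof.
  intros Hw; assert (H := re_le_Cmod w); apply Cmod_gt_0 in Hw.
  apply Rabs_le_between in H.
  split; apply Rmult_le_reg_r with (Cmod w); auto; field_simplify; lra.
Qed.

Lemma Carg_bound (w : C) : - PI <= Carg w <= PI.
Proof.
  unfold Carg; assert (H := acos_bound (Re w / Cmod w)).
  destruct (Rlt_dec (Im w) 0); lra.
Qed.

Lemma Cexp_Clog (w : C) : w <> RtoC 0 -> Cexp (Clog w) = w.
Proof.
  intros Hw; assert (Hb := Re_div_Cmod_bound w Hw).
  assert (Hm : 0 < Cmod w) by (apply Cmod_gt_0; auto).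
  assert (H2 := Cmod2_alt w).
  (* The sine of an [acos] is a nonnegative root, so it only yields [Rabs (Im w)]; the case split in
     [Carg] restores the sign. *)
  assert (Hs : Cmod w * sqrt (1 - (Re w / Cmod w)²) = Rabs (Im w)).
  { rewrite <- (sqrt_Rsqr (Cmod w)) at 1 by lra.
    rewrite <- sqrt_mult_alt by apply Rle_0_sqr.
    rewrite <- sqrt_Rsqr_abs; f_equal; unfold Rsqr; field_simplify; lra. }
  unfold Clog, Cexp; simpl; rewrite exp_ln by auto; unfold Carg.
  destruct (Rlt_dec (Im w) 0) as [Hi|Hi];
    rewrite ?cos_neg, ?sin_neg, cos_acos, sin_acos by auto; apply C_ext; simpl.
  - field; lra.
  - rewrite <- Ropp_mult_distr_r, Hs, Rabs_left; lra.
  - field; lra.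
  - rewrite Hs, Rabs_right; lra.
Qed.

(** [Carg_bound] gives a closed interval, so the strict bounds on [Im p] are what keeps the two
    imaginary parts less than [2 * PI] apart. *)
Lemma Clog_unique (w p : C) : - PI < Im p < PI -> Cexp p = w -> Clog w = p.
Proof.
  intros Hp H; assert (H0 := Carg_bound w).
  apply Cexp_inj.
  - simpl; apply Rabs_def1; lra.
  - rewrite Cexp_Clog; auto; rewrite <- H; apply Cexp_neq_0.
Qed.

Lemma Re_pos_neq_0 (w : C) : 0 < Re w -> w <> RtoC 0.
Proof. intros H ->; simpl in H; lra. Qed.

(** One smooth formula replaces the case split and the [acos] of [Carg], which is not differentiable
    at 1, that is, on the positive axis. [Clog] is differentiated in this form. *)
Lemma Clog_Re_pos (w : C) : 0 < Re w -> Clog w = (ln (Cmod w), atan (Im w / Re w)).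
Proof.
  intros Hw; assert (Hm : 0 < Cmod w) by (apply Cmod_gt_0, Re_pos_neq_0; auto).
  assert (Ha := atan_bound (Im w / Re w)).
  apply Clog_unique; [simpl; lra|].
  assert (Hs : Cmod w = Re w * sqrt (1 + (Im w / Re w)²)).
  { rewrite <- (sqrt_Rsqr (Re w)) at 1 by lra.
    rewrite <- sqrt_mult_alt by apply Rle_0_sqr.
    unfold Cmod; f_equal; unfold Rsqr, Re, Im in *; field; lra. }
  assert (Hq : 0 < sqrt (1 + (Im w / Re w)²)).
  { apply sqrt_lt_R0; assert (H := Rle_0_sqr (Im w / Re w)); lra. }
  unfold Cexp; simpl; rewrite exp_ln, cos_atan, sin_atan by auto.
  apply C_ext; simpl; rewrite Hs; field; lra.
Qed.

Lemma Carg_Re_pos (w : C) : 0 < Re w -> - (PI / 2) < Carg w < PI / 2.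
Proof.
  intros Hw; assert (H := f_equal snd (Clog_Re_pos w Hw)); simpl in H.
  rewrite H; assert (Ha := atan_bound (Im w / Re w)); lra.
Qed.

(** Two arguments in ]-PI/2, PI/2[ add up to one in ]-PI, PI[, so no multiple of 2 PI has to be
    corrected. *)
Lemma Clog_mult_Re_pos (v w : C) :
  0 < Re v -> 0 < Re w -> Clog (v * w) = (Clog v + Clog w)%C.
Proof.
  intros Hv Hw; assert (H1 := Carg_Re_pos v Hv); assert (H2 := Carg_Re_pos w Hw).
  apply Clog_unique; [simpl; lra|].
  rewrite Cexp_plus, !Cexp_Clog; auto using Re_pos_neq_0.
Qed.

Lemma Cexp_opp_Clog (w : C) : w <> RtoC 0 -> Cexp (- Clog w) = (/ w)%C.
Proof. intros Hw; rewrite Cexp_opp, Cexp_Clog; auto. Qed.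

(** * Calculus along curves in the complex plane *)

(** Passing to components brings the complex differentiation rules below within reach of
    [auto_derive]. *)
Lemma is_derive_C (f : R -> C) (x : R) (l : C) :
  is_derive (V := C_R_NormedModule) f x l <->
  is_derive (fun t => Re (f t)) x (Re l) /\ is_derive (fun t => Im (f t)) x (Im l).
Proof.
  split.
  - intros H; split.
    + apply (filterdiff_comp' f (fun p : C_R_NormedModule => fst p) x
        (fun y => scal y l) (fun p : C_R_NormedModule => fst p)); auto.
      apply filterdiff_linear, is_linear_fst.
    + apply (filterdiff_comp' f (fun p : C_R_NormedModule => snd p) x
        (fun y => scal y l) (fun p : C_R_NormedModule => snd p)); auto.
      apply filterdiff_linear, is_linear_snd.
  - intros [H1 H2].
    apply filterdiff_ext with (fun t => (Re (f t), Im (f t))).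
    { intros t; destruct (f t); reflexivity. }
    apply filterdiff_ext_lin with (fun y : R => (scal y (Re l), scal y (Im l)) : C_R_NormedModule).
    2:{ intros y; destruct l; reflexivity. }
    apply (filterdiff_comp'_2 (fun t => Re (f t)) (fun t => Im (f t))
      (fun u v => (u, v) : C_R_NormedModule) x _ _
      (fun u v => (u, v) : C_R_NormedModule) H1 H2).
    eapply filterdiff_ext_lin; [eapply filterdiff_ext; [|apply filterdiff_id]|];
      intros []; reflexivity.
Qed.

Lemma is_derive_Ceq (f : R -> C) (x : R) (l l' : C) :
  is_derive (V := C_R_NormedModule) f x l -> l = l' ->
  is_derive (V := C_R_NormedModule) f x l'.
Proof. intros H <-; exact H. Qed.

Lemma is_derive_Cmult (f g : R -> C) (x : R) (df dg : C) :
  is_derive (V := C_R_NormedModule) f x df ->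
  is_derive (V := C_R_NormedModule) g x dg ->
  is_derive (V := C_R_NormedModule) (fun t => f t * g t)%C x (df * g x + f x * dg)%C.
Proof.
  rewrite !is_derive_C; unfold Re, Im; simpl; intros [Hf1 Hf2] [Hg1 Hg2].
  set (f1 := fun t => fst (f t)) in *; set (f2 := fun t => snd (f t)) in *.
  set (g1 := fun t => fst (g t)) in *; set (g2 := fun t => snd (g t)) in *.
  assert (Ef1 : ex_derive f1 x) by (eexists; eauto).
  assert (Ef2 : ex_derive f2 x) by (eexists; eauto).
  assert (Eg1 : ex_derive g1 x) by (eexists; eauto).
  assert (Eg2 : ex_derive g2 x) by (eexists; eauto).
  assert (DHf1 : Derive (fun t => f1 t) x = fst df) by (apply is_derive_unique, Hf1).
  assert (DHf2 : Derive (fun t => f2 t) x = snd df) by (apply is_derive_unique, Hf2).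
  assert (DHg1 : Derive (fun t => g1 t) x = fst dg) by (apply is_derive_unique, Hg1).
  assert (DHg2 : Derive (fun t => g2 t) x = snd dg) by (apply is_derive_unique, Hg2).
  split.
  - change (is_derive (fun t => f1 t * g1 t - f2 t * g2 t) x
      ((fst df * g1 x - snd df * g2 x) + (f1 x * fst dg - f2 x * snd dg))).
    (* Once opaque, the components are atoms for [auto_derive], which leaves their [Derive] to be
       rewritten with the known values. *)
    clearbody f1 f2 g1 g2; auto_derive; auto; rewrite DHf1, DHf2, DHg1, DHg2; ring.
  - change (is_derive (fun t => f1 t * g2 t + f2 t * g1 t) x
      ((fst df * g2 x + snd df * g1 x) + (f1 x * snd dg + f2 x * fst dg))).
    clearbody f1 f2 g1 g2; auto_derive; auto; rewrite DHf1, DHf2, DHg1, DHg2; ring.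
Qed.

Lemma is_derive_Cconst (c : C) (x : R) :
  is_derive (V := C_R_NormedModule) (fun _ => c) x (RtoC 0).
Proof. apply (is_derive_const (V := C_R_NormedModule) c x). Qed.

Lemma is_derive_Cscal (c : C) (f : R -> C) (x : R) (df : C) :
  is_derive (V := C_R_NormedModule) f x df ->
  is_derive (V := C_R_NormedModule) (fun t => c * f t)%C x (c * df)%C.
Proof.
  intros H; evar_last; [apply is_derive_Cmult; [apply is_derive_Cconst | apply H]|].
  simpl; ring.
Qed.

Lemma is_derive_Cplus (f g : R -> C) (x : R) (df dg : C) :
  is_derive (V := C_R_NormedModule) f x df ->
  is_derive (V := C_R_NormedModule) g x dg ->
  is_derive (V := C_R_NormedModule) (fun t => f t + g t)%C x (df + dg)%C.
Proof. apply (is_derive_plus (V := C_R_NormedModule)). Qed.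

Lemma is_derive_RtoC (f : R -> R) (x df : R) :
  is_derive f x df ->
  is_derive (V := C_R_NormedModule) (fun t => RtoC (f t)) x (RtoC df).
Proof.
  intros H; apply is_derive_C; split; simpl; auto.
  apply (is_derive_const (V := R_NormedModule) 0).
Qed.

Lemma is_derive_RtoC_id (x : R) :
  is_derive (V := C_R_NormedModule) (fun t => RtoC t) x (RtoC 1).
Proof. apply (is_derive_RtoC (fun t => t)), (is_derive_id (K := R_AbsRing)). Qed.

Lemma is_derive_Cexp (f : R -> C) (x : R) (df : C) :
  is_derive (V := C_R_NormedModule) f x df ->
  is_derive (V := C_R_NormedModule) (fun t => Cexp (f t)) x (df * Cexp (f x))%C.
Proof.
  rewrite !is_derive_C; unfold Re, Im; simpl; intros [H1 H2].
  set (f1 := fun t => fst (f t)) in *; set (f2 := fun t => snd (f t)) in *.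
  assert (E1 : ex_derive f1 x) by (eexists; eauto).
  assert (E2 : ex_derive f2 x) by (eexists; eauto).
  assert (DH1 : Derive (fun t => f1 t) x = fst df) by (apply is_derive_unique, H1).
  assert (DH2 : Derive (fun t => f2 t) x = snd df) by (apply is_derive_unique, H2).
  split.
  - change (is_derive (fun t => exp (f1 t) * cos (f2 t)) x
      (fst df * (exp (f1 x) * cos (f2 x)) - snd df * (exp (f1 x) * sin (f2 x)))).
    clearbody f1 f2; auto_derive; auto; rewrite DH1, DH2; ring.
  - change (is_derive (fun t => exp (f1 t) * sin (f2 t)) x
      (fst df * (exp (f1 x) * sin (f2 x)) + snd df * (exp (f1 x) * cos (f2 x)))).
    clearbody f1 f2; auto_derive; auto; rewrite DH1, DH2; ring.
Qed.

Lemma is_derive_Clog (f : R -> C) (x : R) (df : C) :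
  0 < Re (f x) ->
  is_derive (V := C_R_NormedModule) f x df ->
  is_derive (V := C_R_NormedModule) (fun t => Clog (f t)) x (df / f x)%C.
Proof.
  rewrite is_derive_C; unfold Re, Im; intros Hp [H1 H2].
  set (f1 := fun t => fst (f t)) in *; set (f2 := fun t => snd (f t)) in *.
  assert (E1 : ex_derive f1 x) by (eexists; eauto).
  assert (E2 : ex_derive f2 x) by (eexists; eauto).
  assert (Hl : locally x (fun t => 0 < f1 t)).
  { assert (Hc := ex_derive_continuous _ _ E1).
    apply (Hc (fun y => 0 < y)), open_gt, Hp. }
  assert (DH1 : Derive (fun t => f1 t) x = fst df) by (apply is_derive_unique, H1).
  assert (DH2 : Derive (fun t => f2 t) x = snd df) by (apply is_derive_unique, H2).
  change (0 < f1 x) in Hp.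
  assert (Hs : 0 < f1 x * f1 x + f2 x * f2 x) by nra.
  (* The arctangent form holds on the half plane, hence near [x], but not everywhere. *)
  eapply is_derive_ext_loc;
    [eapply filter_imp, Hl; intros t Ht; symmetry; apply (Clog_Re_pos _ Ht)|].
  apply is_derive_C; split.
  - change (is_derive (fun t => ln (sqrt (f1 t ^ 2 + f2 t ^ 2))) x
      (fst df * (f1 x / (f1 x ^ 2 + f2 x ^ 2))
       - snd df * (- f2 x / (f1 x ^ 2 + f2 x ^ 2)))).
    clear Hl; clearbody f1 f2; auto_derive.
    + assert (0 < f1 x * (f1 x * 1) + f2 x * (f2 x * 1)) by nra.
      repeat split; auto; apply sqrt_lt_R0; auto.
    + rewrite DH1, DH2.
      set (r := sqrt _).
      assert (Hr : r * r = f1 x ^ 2 + f2 x ^ 2)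
        by (unfold r; rewrite sqrt_sqrt; [ring|nra]).
      assert (Hr0 : r <> 0) by (intros E; rewrite E in Hr; lra).
      rewrite <- Hr; field; auto.
  - change (is_derive (fun t => atan (f2 t / f1 t)) x
      (fst df * (- f2 x / (f1 x ^ 2 + f2 x ^ 2))
       + snd df * (f1 x / (f1 x ^ 2 + f2 x ^ 2)))).
    clear Hl; clearbody f1 f2; auto_derive.
    + repeat split; auto; lra.
    + rewrite DH1, DH2; field; split; nra.
Qed.

Section Continuity.

Context {T : UniformSpace}.

(** The domain is left general because three are used: the real line, [R * R] for joint continuity
    in the homotopy, and [C] itself for limits of [c * y]. *)
Lemma continuous_C (f : T -> C) (x : T) :
  continuous (fun t => Re (f t)) x -> continuous (fun t => Im (f t)) x ->
  continuous (U := C_R_NormedModule) f x.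
Proof.
  intros H1 H2; apply filterlim_locally; intros eps.
  assert (L1 := proj1 (filterlim_locally _ _) H1 eps).
  assert (L2 := proj1 (filterlim_locally _ _) H2 eps).
  eapply filter_imp, (filter_and _ _ L1 L2).
  intros t [A B]; split; assumption.
Qed.

Lemma continuous_Re (f : T -> C) (x : T) :
  continuous (U := C_R_NormedModule) f x -> continuous (fun t => Re (f t)) x.
Proof. intros H; apply (continuous_comp f fst x H), continuous_fst. Qed.

Lemma continuous_Im (f : T -> C) (x : T) :
  continuous (U := C_R_NormedModule) f x -> continuous (fun t => Im (f t)) x.
Proof. intros H; apply (continuous_comp f snd x H), continuous_snd. Qed.

Lemma continuous_RtoC (f : T -> R) (x : T) :
  continuous f x -> continuous (U := C_R_NormedModule) (fun t => RtoC (f t)) x.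
Proof. intros H; apply continuous_C; [apply H | apply continuous_const]. Qed.

Lemma continuous_Cplus (f g : T -> C) (x : T) :
  continuous (U := C_R_NormedModule) f x -> continuous (U := C_R_NormedModule) g x ->
  continuous (U := C_R_NormedModule) (fun t => f t + g t)%C x.
Proof. apply (continuous_plus (V := C_R_NormedModule)). Qed.

Lemma continuous_Copp (f : T -> C) (x : T) :
  continuous (U := C_R_NormedModule) f x ->
  continuous (U := C_R_NormedModule) (fun t => - f t)%C x.
Proof. apply (continuous_opp (V := C_R_NormedModule)). Qed.

Lemma continuous_Cmult (f g : T -> C) (x : T) :
  continuous (U := C_R_NormedModule) f x -> continuous (U := C_R_NormedModule) g x ->
  continuous (U := C_R_NormedModule) (fun t => f t * g t)%C x.
Proof.
  intros Hf Hg.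
  assert (F1 := continuous_Re _ _ Hf); assert (F2 := continuous_Im _ _ Hf).
  assert (G1 := continuous_Re _ _ Hg); assert (G2 := continuous_Im _ _ Hg).
  apply continuous_C.
  - apply (continuous_minus (V := R_NormedModule));
      apply (continuous_mult (K := R_AbsRing)); assumption.
  - apply (continuous_plus (V := R_NormedModule));
      apply (continuous_mult (K := R_AbsRing)); assumption.
Qed.

Lemma continuous_Cexp (f : T -> C) (x : T) :
  continuous (U := C_R_NormedModule) f x ->
  continuous (U := C_R_NormedModule) (fun t => Cexp (f t)) x.
Proof.
  intros Hf.
  assert (F1 := continuous_Re _ _ Hf); assert (F2 := continuous_Im _ _ Hf).
  assert (E := continuous_comp (fun t => Re (f t)) exp x F1 (continuous_exp _)).
  assert (K := continuous_comp (fun t => Im (f t)) cos x F2 (continuous_cos _)).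
  assert (S := continuous_comp (fun t => Im (f t)) sin x F2 (continuous_sin _)).
  apply continuous_C.
  - exact (continuous_mult (K := R_AbsRing) _ _ x E K).
  - exact (continuous_mult (K := R_AbsRing) _ _ x E S).
Qed.

Lemma continuous_Clog (f : T -> C) (x : T) :
  0 < Re (f x) ->
  continuous (U := C_R_NormedModule) f x ->
  continuous (U := C_R_NormedModule) (fun t => Clog (f t)) x.
Proof.
  intros Hp Hf.
  assert (F1 := continuous_Re _ _ Hf); assert (F2 := continuous_Im _ _ Hf).
  assert (Hl : locally x (fun t => 0 < Re (f t))).
  { apply (F1 (fun y => 0 < y)), open_gt, Hp. }
  eapply continuous_ext_loc;
    [eapply filter_imp, Hl; intros t Ht; symmetry; apply (Clog_Re_pos _ Ht)|].
  apply continuous_C; simpl.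
  - apply (continuous_comp (fun t => Cmod (f t)) ln).
    + apply (continuous_comp (fun t => (fst (f t)) ^ 2 + (snd (f t)) ^ 2) sqrt).
      * apply (continuous_plus (V := R_NormedModule)).
        -- apply (continuous_comp (fun t => Re (f t)) (fun y => y ^ 2)); auto.
           apply (ex_derive_continuous (V := R_NormedModule)); auto_derive; auto.
        -- apply (continuous_comp (fun t => Im (f t)) (fun y => y ^ 2)); auto.
           apply (ex_derive_continuous (V := R_NormedModule)); auto_derive; auto.
      * apply continuous_sqrt.
    + apply (ex_derive_continuous (V := R_NormedModule)); auto_derive.
      apply Cmod_gt_0, Re_pos_neq_0, Hp.
  - apply (continuous_comp (fun t => Im (f t) / Re (f t)) atan).
    + apply (continuous_mult (K := R_AbsRing)); auto.
      apply (continuous_comp (fun t => Re (f t)) Rinv); auto.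
      apply (ex_derive_continuous (V := R_NormedModule)); auto_derive; lra.
    + apply (ex_derive_continuous (V := R_NormedModule)); auto_derive; auto.
Qed.

End Continuity.

(** * Improper integrals and exponential decay *)

Lemma norm_Cmod (x : C) : norm (V := C_R_NormedModule) x = Cmod x.
Proof.
  change (sqrt (Rabs (fst x) ^ 2 + Rabs (snd x) ^ 2) = Cmod x).
  unfold Cmod; rewrite !pow2_abs; reflexivity.
Qed.

(** With [at_point a] at the lower end, an improper integral is a limit of proper ones; this lemma
    and the next pass between the two forms. *)
Lemma is_RInt_gen_p_infty {V : NormedModule R_AbsRing} (f F : R -> V) (a : R) (l : V) :
  (forall b, a <= b -> is_RInt f a b (F b)) ->
  filterlim F (Rbar_locally p_infty) (locally l) ->
  is_RInt_gen f (at_point a) (Rbar_locally p_infty) l.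
Proof.
  intros H Hl P HP; unfold filtermapi.
  apply Filter_prod with (fun x => x = a) (fun b => a <= b /\ P (F b)).
  - reflexivity.
  - apply filter_and; [exists a; intros; lra | apply (Hl P HP)].
  - intros x b -> [Hb HPb]; exists (F b); simpl; auto.
Qed.

Lemma filterlim_RInt_gen_p_infty {V : CompleteNormedModule R_AbsRing} (f : R -> V) (a : R) (l : V) :
  is_RInt_gen f (at_point a) (Rbar_locally p_infty) l ->
  filterlim (fun b => RInt f a b) (Rbar_locally p_infty) (locally l).
Proof.
  intros H P HP; destruct (H P HP) as [Q S HQ HS Hi].
  apply (filter_imp (F := Rbar_locally p_infty) S); [intros b Hb | exact HS].
  destruct (Hi a b HQ Hb) as [y [Hy HPy]]; simpl in Hy.
  rewrite (is_RInt_unique _ _ _ _ Hy); exact HPy.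
Qed.

Lemma is_RInt_exp_decay (K lam a b : R) :
  0 < lam -> is_RInt (fun t => K * exp (- lam * t)) a b
    (K / lam * exp (- lam * a) - K / lam * exp (- lam * b)).
Proof.
  intros Hl.
  replace (_ - _) with (minus (- (K / lam) * exp (- lam * b)) (- (K / lam) * exp (- lam * a)))
    by (unfold minus, plus, opp; simpl; ring).
  apply (is_RInt_derive (V := R_CompleteNormedModule) (fun t => - (K / lam) * exp (- lam * t))).
  - intros x _; auto_derive; auto; field; lra.
  - intros x _; apply (ex_derive_continuous (V := R_NormedModule)); auto_derive; auto.
Qed.

Lemma is_lim_exp_decay (K lam : R) :
  0 < lam -> is_lim (fun t => K * exp (- lam * t)) p_infty 0.
Proof.
  intros Hl.
  replace (Finite 0) with (Rbar_mult K 0) by (simpl; f_equal; ring).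
  apply is_lim_scal_l, is_lim_comp with m_infty.
  - apply is_lim_exp_m.
  - replace m_infty with (Rbar_mult (- lam) p_infty).
    + apply is_lim_scal_l, is_lim_id.
    + apply is_Rbar_mult_unique, is_Rbar_mult_sym, is_Rbar_mult_p_infty_neg; simpl; lra.
  - exists 0; intros; discriminate.
Qed.

(** Cauchy's criterion: the integral over [u, v] is at most the tail [K / lam * exp (- lam * u)]. *)
Lemma ex_RInt_gen_exp_decay (f : R -> C) (a K lam : R) :
  0 < lam ->
  (forall t, a <= t -> Cmod (f t) <= K * exp (- lam * t)) ->
  (forall b, a <= b -> ex_RInt (V := C_R_NormedModule) f a b) ->
  ex_RInt_gen (V := C_R_NormedModule) f (at_point a) (Rbar_locally p_infty).
Proof.
  intros Hl Hb Hi.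
  (* The bound at [t = a] forces the sign of [K], which later allows the term of the upper end [v]
     to be dropped. *)
  assert (HK : 0 <= K).
  { apply Rmult_le_reg_r with (exp (- lam * a)); [apply exp_pos|].
    rewrite Rmult_0_l; eapply Rle_trans, (Hb a); [apply Cmod_ge_0 | lra]. }
  set (F := (fun b => RInt (V := C_R_CompleteNormedModule) f a b) : R -> C).
  assert (HF : forall b, a <= b -> is_RInt (V := C_R_NormedModule) f a b (F b)).
  { intros b Hab; apply (RInt_correct (V := C_R_CompleteNormedModule)), Hi, Hab. }
  assert (Hdiff : forall u v, a <= u <= v ->
    norm (V := C_R_NormedModule) (F v - F u)%C <= K / lam * exp (- lam * u)).
  { intros u v Huv.
    assert (HR : is_RInt (V := C_R_NormedModule) f u v (F v - F u)%C).
    { replace (F v - F u)%C with (- F u + F v)%C by ring.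
      apply (is_RInt_Chasles (V := C_R_NormedModule) f u a v (- F u)%C (F v));
        [apply (is_RInt_swap (V := C_R_NormedModule) f)|]; apply HF; lra. }
    eapply Rle_trans.
    - eapply norm_RInt_le; [apply Huv | | exact HR | apply (is_RInt_exp_decay K lam u v Hl)].
      intros t Ht; rewrite norm_Cmod; apply Hb; lra.
    - assert (0 <= K / lam * exp (- lam * v)); [|lra].
      apply Rmult_le_pos; [apply Rdiv_le_0_compat|apply Rlt_le, exp_pos]; auto. }
  destruct (proj1 (filterlim_locally_cauchy (U := C_R_CompleteNormedModule)
    (F := Rbar_locally p_infty) F)) as [l Hlim].
  2:{ exists l; apply is_RInt_gen_p_infty with F; auto. }
  intros eps.
  assert (Hlim := is_lim_exp_decay (K / lam) lam Hl).
  apply is_lim_spec in Hlim; specialize (Hlim eps); simpl in Hlim.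
  exists (fun u => a <= u /\ K / lam * exp (- lam * u) < eps); split.
  { apply filter_and; [exists a; intros; lra|].
    destruct Hlim as [B HB]; exists B; intros x Hx; specialize (HB x Hx).
    rewrite Rminus_0_r in HB; apply Rabs_lt_between in HB; lra. }
  intros u v [Hu1 Hu2] [Hv1 Hv2].
  destruct (Rle_dec u v).
  - apply (norm_compat1 (V := C_R_NormedModule)).
    eapply Rle_lt_trans; [apply Hdiff; lra|auto].
  - apply ball_sym, (norm_compat1 (V := C_R_NormedModule)).
    eapply Rle_lt_trans; [apply Hdiff; lra|auto].
Qed.

(** [powexp L s w] is [w^(-s) e^(-L w)]. *)
Definition powexp (L s w : C) : C := Cexp (- (s * Clog w) - L * w).

(** Upper side: [y <= exp y] at [y = ln (eps * x)]. Lower side: [ln delta <= ln x]. This is how a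
    power of [w] gets absorbed into an arbitrarily slow exponential. *)
Lemma Rabs_ln_le (delta eps : R) : 0 < delta -> 0 < eps ->
  exists A, forall x, delta <= x -> Rabs (ln x) <= eps * x + A.
Proof.
  intros Hd He; exists (Rabs (ln delta) + Rabs (ln eps)); intros x Hx.
  assert (H1 : ln delta <= ln x) by (apply ln_le; lra).
  assert (H2 : ln (eps * x) <= eps * x).
  { assert (H := exp_ineq1_le (ln (eps * x))); rewrite exp_ln in H; nra. }
  rewrite ln_mult in H2 by lra.
  assert (H3 := Rle_abs (- ln eps)); rewrite Rabs_Ropp in H3.
  assert (H4 := Rle_abs (- ln delta)); rewrite Rabs_Ropp in H4.
  assert (H5 := Rabs_pos (ln delta)); assert (H6 := Rabs_pos (ln eps)).
  apply Rabs_le; split; nra.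
Qed.

(** The modulus of [w^(-s)] is the exponential of [- Re s * ln |w| + Im s * arg w]. The argument is
    bounded by [PI], so only the logarithm has to be paid for with [eps]. *)
Lemma Cmod_powexp_le (L s : C) (delta eps : R) : 0 < delta -> 0 < eps ->
  exists K, 0 < K /\ forall w, delta <= Re w ->
    Cmod (powexp L s w) <= K * exp (eps * Cmod w - Re (L * w)).
Proof.
  intros Hd He.
  assert (Hs := Rabs_pos (Re s)).
  (* The [+ 1] covers the case [Re s = 0]. *)
  destruct (Rabs_ln_le delta (eps / (Rabs (Re s) + 1))) as [A HA]; auto.
  { apply Rdiv_lt_0_compat; lra. }
  exists (exp (Rabs (Re s) * A + Rabs (Im s) * PI)); split; [apply exp_pos|].
  intros w Hw; unfold powexp; rewrite Cmod_Cexp, <- exp_plus.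
  assert (Hm : delta <= Cmod w).
  { assert (H := re_le_Cmod w); apply Rabs_le_between in H; lra. }
  specialize (HA _ Hm).
  assert (E : Re (- (s * Clog w) - L * w)
    = - (Re s * ln (Cmod w)) + Im s * Carg w - Re (L * w)).
  { unfold Cminus; rewrite re_plus, !re_opp, (re_mult s); unfold Clog, Re, Im; simpl; ring. }
  rewrite E.
  assert (T1 : - (Re s * ln (Cmod w)) <= Rabs (Re s) * Rabs (ln (Cmod w))).
  { rewrite <- Rabs_mult, <- Rabs_Ropp; apply Rle_abs. }
  assert (T2 : Im s * Carg w <= Rabs (Im s) * PI).
  { eapply Rle_trans; [apply Rle_abs|]; rewrite Rabs_mult.
    apply Rmult_le_compat_l; [apply Rabs_pos|].
    apply Rabs_le, Carg_bound. }
  assert (T3 : Rabs (Re s) * Rabs (ln (Cmod w)) <= Rabs (Re s) * A + eps * Cmod w).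
  { eapply Rle_trans; [apply Rmult_le_compat_l; [auto|apply HA]|].
    assert (Rabs (Re s) * (eps / (Rabs (Re s) + 1)) <= eps).
    { apply Rmult_le_reg_r with (Rabs (Re s) + 1); [lra|]; field_simplify; lra. }
    nra. }
  destruct (Rle_lt_or_eq_dec
    (- (Re s * ln (Cmod w)) + Im s * Carg w - Re (L * w))
    (Rabs (Re s) * A + Rabs (Im s) * PI + (eps * Cmod w - Re (L * w)))) as [H|H]; [lra| |].
  - apply Rlt_le, exp_increasing, H.
  - rewrite H; lra.
Qed.

(** [K] is chosen before the direction [e]: the rotation needs one bound for a whole sector. *)
Lemma powexp_decay (L s c : C) (mu E : R) : 0 < Re c -> 0 < mu ->
  exists K, forall (e : C) (u : R), 0 <= u -> 0 <= Re e -> Cmod e <= E -> mu <= Re (L * e) ->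
    Cmod (powexp L s (c + RtoC u * e)) <= K * exp (- (mu / 2) * u).
Proof.
  intros Hc Hmu.
  (* Chosen so that [eps * Cmod e <= mu / 2]; the power thus costs half of the decay rate. *)
  set (eps := mu / (2 * (Rabs E + 1))).
  assert (HE := Rabs_pos E).
  assert (Heps : 0 < eps) by (apply Rdiv_lt_0_compat; lra).
  destruct (Cmod_powexp_le L s (Re c) eps Hc Heps) as [K [HK Hb]].
  exists (K * exp (eps * Cmod c - Re (L * c))); intros e u Hu He HEe Hm.
  eapply Rle_trans; [apply Hb; rewrite re_plus, re_scal_l; nra|].
  rewrite Rmult_assoc, <- exp_plus; apply Rmult_le_compat_l; [lra|].
  assert (Hle : eps * Cmod (c + RtoC u * e) - Re (L * (c + RtoC u * e))
    <= eps * Cmod c - Re (L * c) + - (mu / 2) * u).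
  { assert (T := Cmod_triangle c (RtoC u * e)).
    rewrite Cmod_mult, Cmod_R, Rabs_right in T by lra.
    replace (L * (c + RtoC u * e))%C with (L * c + RtoC u * (L * e))%C by ring.
    rewrite re_plus, re_scal_l.
    assert (B : eps * Cmod e <= mu / 2).
    { apply Rle_trans with (eps * Rabs E).
      - apply Rmult_le_compat_l; [lra|]; assert (H := Rle_abs E); lra.
      - unfold eps; apply Rmult_le_reg_r with (2 * (Rabs E + 1)); [lra|].
        field_simplify; nra. }
    nra. }
  destruct Hle as [H|H]; [apply Rlt_le, exp_increasing, H | rewrite H; lra].
Qed.

(** * Rotation of the ray of integration *)

Lemma is_derive_powexp (L s : C) (w : R -> C) (x : R) (dw : C) :
  0 < Re (w x) ->
  is_derive (V := C_R_NormedModule) w x dw ->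
  is_derive (V := C_R_NormedModule) (fun t => powexp L s (w t)) x
    ((- s * powexp L (s + 1) (w x) - L * powexp L s (w x)) * dw)%C.
Proof.
  intros Hp Hw.
  assert (H0 := Re_pos_neq_0 _ Hp).
  assert (E : powexp L (s + 1) (w x) = (powexp L s (w x) / w x)%C).
  { unfold powexp, Cdiv; rewrite <- (Cexp_opp_Clog (w x) H0), <- Cexp_plus.
    f_equal; ring. }
  assert (H := is_derive_Cexp _ x _
    (is_derive_Cplus _ _ x _ _
      (is_derive_Cscal (- s) _ x _ (is_derive_Clog w x dw Hp Hw))
      (is_derive_Cscal (- L) w x dw Hw))).
  assert (Ew : forall t, (- s * Clog (w t) + - L * w t)%C = (- (s * Clog (w t)) - L * w t)%C)
    by (intros; ring).
  apply (is_derive_ext (fun t => Cexp (- s * Clog (w t) + - L * w t)%C)).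
  { intros t; unfold powexp; f_equal; apply Ew. }
  evar_last; [exact H|].
  rewrite E; unfold powexp; rewrite <- Ew; cbv beta; field; auto.
Qed.

Lemma continuous_powexp {T : UniformSpace} (L s : C) (w : T -> C) (x : T) :
  0 < Re (w x) ->
  continuous (U := C_R_NormedModule) w x ->
  continuous (U := C_R_NormedModule) (fun t => powexp L s (w t)) x.
Proof.
  intros Hp Hw; unfold powexp, Cminus.
  apply continuous_Cexp, continuous_Cplus; apply continuous_Copp, continuous_Cmult; auto.
  - apply continuous_const.
  - apply continuous_Clog; auto.
  - apply continuous_const.
Qed.

(** With [k x u = h (c + e x * u) * e x] the primitive in [u] of the derivative of [k]
    in [x] is [P x u = h (c + e x * u) * e' x * u], so only the outer boundary of the
    sector contributes: Cauchy's theorem on a triangle. *)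
Lemma is_RInt_homotopy_R (k kx P : R -> R -> R) (A eta : R) : 0 <= A -> 0 < eta ->
  (forall x u, - eta < x < 1 + eta -> - eta < u ->
    is_derive (fun y => k y u) x (kx x u) /\ is_derive (P x) u (kx x u) /\
    continuous (fun z : R * R => kx (fst z) (snd z)) (x, u) /\
    continuous (k x) u /\ continuous (fun y => P y u) x) ->
  is_RInt (fun x => P x A - P x 0) 0 1 (RInt (k 1) 0 A - RInt (k 0) 0 A).
Proof.
  intros HA Heta H.
  apply (is_RInt_derive (V := R_CompleteNormedModule) (fun x => RInt (k x) 0 A)).
  2:{ intros x Hx; rewrite Rmin_left, Rmax_right in Hx by lra.
      apply (continuous_minus (V := R_NormedModule)); apply H; lra. }
  intros x Hx; rewrite Rmin_left, Rmax_right in Hx by lra.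
  (* The margin [eta] makes the hypotheses hold on a full neighbourhood of the ends [x = 0] and
     [x = 1], as two-sided derivatives require. *)
  assert (Hloc : locally x (fun y => - eta < y < 1 + eta)).
  { exists (mkposreal eta Heta); intros y Hy.
    apply Rabs_lt_between in Hy; unfold minus, plus, opp in Hy; simpl in Hy; lra. }
  assert (HD : forall y u, - eta < y < 1 + eta -> - eta < u ->
    Derive (fun z => k z u) y = kx y u).
  { intros y u Hy Hu; apply is_derive_unique, H; auto. }
  evar_last.
  - apply is_derive_RInt_param.
    + eapply filter_imp, Hloc; intros y Hy t Ht.
      rewrite Rmin_left in Ht by lra.
      exists (kx y t); destruct (H y t) as [D _]; [lra|lra|exact D].
    + intros t Ht; rewrite Rmin_left in Ht by lra.
      apply (continuity_2d_pt_ext_loc kx).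
      * destruct Hloc as [e1 He1].
        exists (mkposreal (Rmin e1 eta) (Rmin_pos _ _ (cond_pos e1) Heta)); simpl.
        intros y u Hy Hu; symmetry; apply HD.
        -- apply He1; eapply Rlt_le_trans; [exact Hy|apply Rmin_l].
        -- apply Rlt_le_trans with (r3 := eta) in Hu; [|apply Rmin_r].
           apply Rabs_lt_between in Hu; lra.
      * apply continuity_2d_pt_filterlim, (H x t); lra.
    + eapply filter_imp, Hloc; intros y Hy.
      apply (ex_RInt_continuous (V := R_CompleteNormedModule)); intros u Hu.
      rewrite Rmin_left in Hu by lra; apply H; lra.
  (* The integral of [kx x] over [0, A] is evaluated by its primitive [P x] in the other
     variable. *)
  - apply is_RInt_unique.
    apply is_RInt_ext with (kx x).
    + intros u Hu; rewrite Rmin_left in Hu by lra; symmetry; apply HD; lra.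
    + apply (is_RInt_derive (V := R_CompleteNormedModule) (P x)); intros u Hu;
        rewrite Rmin_left in Hu by lra; destruct (H x u) as (_ & H1 & H2 & _); try lra; auto.
      apply (continuous_comp_2 (fun _ => x) (fun u => u) kx); auto.
      * apply continuous_const.
      * apply continuous_id.
Qed.

Lemma is_RInt_C (f : R -> C) (a b : R) (l : C) :
  is_RInt (V := C_R_NormedModule) f a b l <->
  is_RInt (fun t => Re (f t)) a b (Re l) /\ is_RInt (fun t => Im (f t)) a b (Im l).
Proof.
  split.
  - intros H; split.
    + exact (is_RInt_fct_extend_fst (U := R_NormedModule) (V := R_NormedModule) f a b l H).
    + exact (is_RInt_fct_extend_snd (U := R_NormedModule) (V := R_NormedModule) f a b l H).
  - intros [H1 H2]; destruct l as [l1 l2].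
    exact (is_RInt_fct_extend_pair (U := R_NormedModule) (V := R_NormedModule) f a b l1 l2 H1 H2).
Qed.

Lemma ex_RInt_C_continuous (f : R -> C) (a b : R) : a <= b ->
  (forall t, a <= t <= b -> continuous (U := C_R_NormedModule) f t) ->
  ex_RInt (V := C_R_NormedModule) f a b.
Proof.
  intros Hab H; apply (ex_RInt_continuous (V := C_R_CompleteNormedModule)); intros t Ht.
  rewrite Rmin_left, Rmax_right in Ht by lra; apply H, Ht.
Qed.

Lemma is_RInt_homotopy (k kx P : R -> R -> C) (A eta : R) (l0 l1 : C) : 0 <= A -> 0 < eta ->
  (forall x u, - eta < x < 1 + eta -> - eta < u ->
    is_derive (V := C_R_NormedModule) (fun y => k y u) x (kx x u) /\
    is_derive (V := C_R_NormedModule) (P x) u (kx x u) /\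
    continuous (U := C_R_NormedModule) (fun z : R * R => kx (fst z) (snd z)) (x, u) /\
    continuous (U := C_R_NormedModule) (k x) u /\
    continuous (U := C_R_NormedModule) (fun y => P y u) x) ->
  is_RInt (V := C_R_NormedModule) (k 0) 0 A l0 ->
  is_RInt (V := C_R_NormedModule) (k 1) 0 A l1 ->
  is_RInt (V := C_R_NormedModule) (fun x => P x A - P x 0)%C 0 1 (l1 - l0)%C.
Proof.
  intros HA Heta H H0 H1.
  apply is_RInt_C in H0; apply is_RInt_C in H1; apply is_RInt_C; split.
  - replace (Re (l1 - l0)) with (Re l1 - Re l0) by reflexivity.
    rewrite <- (is_RInt_unique _ _ _ _ (proj1 H1)), <- (is_RInt_unique _ _ _ _ (proj1 H0)).
    apply (is_RInt_homotopy_R (fun x u => Re (k x u)) (fun x u => Re (kx x u))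
      (fun x u => Re (P x u)) A eta HA Heta).
    intros x u Hx Hu; destruct (H x u Hx Hu) as (D1 & D2 & C1 & C2 & C3).
    apply is_derive_C in D1; apply is_derive_C in D2.
    split; [apply D1|split; [apply D2|]].
    split; [apply (continuous_Re _ _ C1)|split].
    + apply (continuous_Re _ _ C2).
    + apply (continuous_Re _ _ C3).
  - replace (Im (l1 - l0)) with (Im l1 - Im l0) by reflexivity.
    rewrite <- (is_RInt_unique _ _ _ _ (proj2 H1)), <- (is_RInt_unique _ _ _ _ (proj2 H0)).
    apply (is_RInt_homotopy_R (fun x u => Im (k x u)) (fun x u => Im (kx x u))
      (fun x u => Im (P x u)) A eta HA Heta).
    intros x u Hx Hu; destruct (H x u Hx Hu) as (D1 & D2 & C1 & C2 & C3).
    apply is_derive_C in D1; apply is_derive_C in D2.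
    split; [apply D1|split; [apply D2|]].
    split; [apply (continuous_Im _ _ C1)|split].
    + apply (continuous_Im _ _ C2).
    + apply (continuous_Im _ _ C3).
Qed.

(** The scalars of [C_R_NormedModule] are real, so linearity over [C] is recovered from the
    components. *)
Lemma is_RInt_Cmult (c : C) (f : R -> C) (a b : R) (l : C) :
  is_RInt (V := C_R_NormedModule) f a b l ->
  is_RInt (V := C_R_NormedModule) (fun t => c * f t)%C a b (c * l)%C.
Proof.
  rewrite !is_RInt_C; intros [H1 H2]; split.
  - exact (is_RInt_minus _ _ _ _ _ _
      (is_RInt_scal _ _ _ (Re c) _ H1) (is_RInt_scal _ _ _ (Im c) _ H2)).
  - exact (is_RInt_plus _ _ _ _ _ _
      (is_RInt_scal _ _ _ (Re c) _ H2) (is_RInt_scal _ _ _ (Im c) _ H1)).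
Qed.

Lemma is_RInt_gen_Cmult (c : C) (f : R -> C) (Fa Fb : (R -> Prop) -> Prop)
    {FFa : Filter Fa} {FFb : Filter Fb} (l : C) :
  is_RInt_gen (V := C_R_NormedModule) f Fa Fb l ->
  is_RInt_gen (V := C_R_NormedModule) (fun t => c * f t)%C Fa Fb (c * l)%C.
Proof.
  intros H P HP.
  assert (Hc : continuous (T := C_R_NormedModule) (U := C_R_NormedModule) (fun y : C => c * y)%C l).
  { apply (continuous_Cmult (T := C_R_NormedModule) (fun _ => c) (fun y => y)).
    - apply continuous_const.
    - apply continuous_id. }
  assert (Hl := H _ (Hc P HP)); unfold filtermapi in *.
  eapply filter_imp, Hl; intros [a b] [y [Hy HPy]].
  exists (c * y)%C; split; auto; apply is_RInt_Cmult, Hy.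
Qed.

(** Half of the exponential absorbs [t]: by [1 + y <= exp y],
    [t * exp (- (lam / 2) * t) <= 2 / lam]. The factor [t] comes from the length of the outer side
    of the triangle in the rotation. *)
Lemma is_lim_mult_exp_decay (K lam : R) :
  0 < lam -> is_lim (fun t => K * t * exp (- lam * t)) p_infty 0.
Proof.
  intros Hl.
  apply (is_lim_le_le_loc (fun t => - (Rabs K * (2 / lam) * exp (- (lam / 2) * t)))
    (fun t => Rabs K * (2 / lam) * exp (- (lam / 2) * t))).
  - exists 0; intros t Ht.
    assert (Hb : Rabs (K * t * exp (- lam * t)) <= Rabs K * (2 / lam) * exp (- (lam / 2) * t)).
    { replace (- lam * t) with (- (lam / 2) * t + - (lam / 2 * t)) by field.
      rewrite exp_plus, !Rabs_mult, (Rabs_right t), !(Rabs_right (exp _)) by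
        (try lra; apply Rle_ge, Rlt_le, exp_pos).
      rewrite exp_Ropp.
      assert (H1 := exp_ineq1_le (lam / 2 * t)).
      assert (Ht2 : t * / exp (lam / 2 * t) <= 2 / lam).
      { apply Rmult_le_reg_r with (exp (lam / 2 * t)); [apply exp_pos|].
        rewrite Rmult_assoc, Rinv_l by (apply Rgt_not_eq, exp_pos).
        apply Rmult_le_reg_l with (lam / 2); [lra|].
        replace (lam / 2 * (2 / lam * exp (lam / 2 * t))) with (exp (lam / 2 * t)) by (field; lra).
        lra. }
      replace (Rabs K * t * (exp (- (lam / 2) * t) * / exp (lam / 2 * t)))
        with (Rabs K * exp (- (lam / 2) * t) * (t * / exp (lam / 2 * t))) by ring.
      replace (Rabs K * (2 / lam) * exp (- (lam / 2) * t))
        with (Rabs K * exp (- (lam / 2) * t) * (2 / lam)) by ring.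
      apply Rmult_le_compat_l; auto.
      apply Rmult_le_pos; [apply Rabs_pos|apply Rlt_le, exp_pos]. }
    apply Rabs_le_between in Hb; exact Hb.
  - replace (Finite 0) with (Rbar_opp 0) by (simpl; f_equal; ring).
    apply (is_lim_opp (fun t => Rabs K * (2 / lam) * exp (- (lam / 2) * t))).
    apply is_lim_exp_decay; lra.
  - apply is_lim_exp_decay; lra.
Qed.

Lemma filterlim_C_0 {T : Type} {F : (T -> Prop) -> Prop} {FF : Filter F} (f : T -> C) (g : T -> R) :
  F (fun t => Cmod (f t) <= g t) -> filterlim g F (locally 0) ->
  filterlim f F (locally (T := C_R_NormedModule) (RtoC 0)).
Proof.
  intros H Hg; apply filterlim_locally; intros eps.
  assert (He := proj1 (filterlim_locally _ _) Hg eps).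
  apply (filter_imp (fun t => Cmod (f t) <= g t /\ ball 0 eps (g t)));
    [intros t [A B] | apply filter_and; [exact H | exact He]].
  apply (norm_compat1 (V := C_R_NormedModule)).
  apply Rabs_lt_between in B; unfold minus, plus, opp in B; simpl in B.
  change (norm (V := C_R_NormedModule) (f t - 0)%C < eps).
  rewrite norm_Cmod; replace (f t - 0)%C with (f t) by ring; lra.
Qed.

Lemma filterlim_Cplus {T : Type} {F : (T -> Prop) -> Prop} {FF : Filter F} (f g : T -> C) (x y : C) :
  filterlim f F (locally (T := C_R_NormedModule) x) ->
  filterlim g F (locally (T := C_R_NormedModule) y) ->
  filterlim (fun t => f t + g t)%C F (locally (T := C_R_NormedModule) (x + y)%C).
Proof.
  intros Hf Hg; eapply filterlim_comp_2; [exact Hf | exact Hg |].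
  apply (filterlim_plus (V := C_R_NormedModule)).
Qed.

Lemma filterlim_Copp {T : Type} {F : (T -> Prop) -> Prop} (f : T -> C) (x : C) :
  filterlim f F (locally (T := C_R_NormedModule) x) ->
  filterlim (fun t => - f t)%C F (locally (T := C_R_NormedModule) (- x)%C).
Proof.
  intros Hf; eapply filterlim_comp; [exact Hf|].
  apply (filterlim_opp (V := C_R_NormedModule)).
Qed.

(** Provides the margin [eta] required by [is_RInt_homotopy]: the triangle stays in the half plane
    even when slightly enlarged. *)
Lemma Re_affine_pos (c p d : C) : 0 < Re c -> 0 < Re p -> 0 < Re d ->
  exists eta, 0 < eta /\ forall x u, - eta < x < 1 + eta -> - eta < u ->
    0 < Re (c + RtoC u * (p + RtoC x * (d - p))).
Proof.
  intros Hc Hp Hd.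
  set (q := Re p) in *; set (r := Re d) in *.
  set (m := Rmin (Rmin q r) (Re c / 3)).
  assert (M1 : m <= q) by (eapply Rle_trans; [apply Rmin_l|apply Rmin_l]).
  assert (M2 : m <= r) by (eapply Rle_trans; [apply Rmin_l|apply Rmin_r]).
  assert (M3 : m <= Re c / 3) by apply Rmin_r.
  assert (M0 : 0 < m) by (repeat apply Rmin_glb_lt; lra).
  exists (m / (q + r)); set (eta := m / (q + r)).
  assert (E : eta * (q + r) = m) by (unfold eta; field; lra).
  assert (E0 : 0 < eta) by (apply Rdiv_lt_0_compat; lra).
  split; auto; intros x u Hx Hu.
  replace (Re _) with (Re c + u * (q + x * (r - q)))
    by (unfold Cminus; rewrite re_plus, re_scal_l, re_plus, re_scal_l, re_plus, re_opp; reflexivity).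
  assert (P1 : 0 < q + x * (r - q)).
  { destruct (Rle_dec x 0); [nra|]; destruct (Rle_dec x 1); nra. }
  assert (P2 : q + x * (r - q) <= 2 * (q + r)).
  { assert (eta <= 1) by (unfold eta; apply Rmult_le_reg_r with (q + r); [lra|]; field_simplify; lra).
    nra. }
  destruct (Rle_dec 0 u); nra.
Qed.

Section Rotation.

Variables (L s c p d : C).
Hypotheses (Hc : 0 < Re c) (Hp : 0 < Re p) (Hd : 0 < Re d).

Lemma is_RInt_powexp_rotate (A : R) (lp ld : C) : 0 <= A ->
  is_RInt (V := C_R_NormedModule) (fun u => p * powexp L s (c + RtoC u * p))%C 0 A lp ->
  is_RInt (V := C_R_NormedModule) (fun u => d * powexp L s (c + RtoC u * d))%C 0 A ld ->
  is_RInt (V := C_R_NormedModule)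
    (fun x => RtoC A * (d - p) * powexp L s (c + RtoC A * (p + RtoC x * (d - p))))%C
    0 1 (ld - lp)%C.
Proof.
  intros HA H0 H1.
  destruct (Re_affine_pos c p d Hc Hp Hd) as (eta & Heta & Hpos).
  set (e := fun x => (p + RtoC x * (d - p))%C).
  set (w := fun x u => (c + RtoC u * e x)%C).
  set (Dp := fun z => (- s * powexp L (s + 1) z - L * powexp L s z)%C).
  (* Restores the vanishing term [P x 0], the contribution of the vertex [c]. *)
  apply (is_RInt_ext (V := C_R_NormedModule) (fun x =>
    RtoC A * (d - p) * powexp L s (w x A) - RtoC 0 * (d - p) * powexp L s (w x 0%R))%C).
  { intros x _; unfold w, e; apply Ceq_minus; ring. }
  apply (is_RInt_homotopy (fun x u => e x * powexp L s (w x u))%C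
    (fun x u => (d - p) * powexp L s (w x u) + e x * (Dp (w x u) * (RtoC u * (d - p))))%C
    (fun x u => RtoC u * (d - p) * powexp L s (w x u))%C A eta); auto.
  - intros x u Hx Hu.
    assert (Hw : 0 < Re (w x u)) by (apply Hpos; auto).
    assert (De : is_derive (V := C_R_NormedModule) e x (d - p)%C).
    { eapply is_derive_Ceq; [apply is_derive_Cplus; [apply is_derive_Cconst|];
        apply is_derive_Cmult; [apply is_derive_RtoC_id | apply is_derive_Cconst]|].
      cbv beta; ring. }
    assert (Dwx : is_derive (V := C_R_NormedModule) (fun y => w y u) x (RtoC u * (d - p))%C).
    { eapply is_derive_Ceq; [apply is_derive_Cplus; [apply is_derive_Cconst|];
        apply is_derive_Cscal, De|].
      cbv beta; ring. }
    assert (Dwu : is_derive (V := C_R_NormedModule) (w x) u (e x)).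
    { eapply is_derive_Ceq; [apply is_derive_Cplus; [apply is_derive_Cconst|];
        apply is_derive_Cmult; [apply is_derive_RtoC_id | apply is_derive_Cconst]|].
      cbv beta; ring. }
    assert (Ce : forall (T : UniformSpace) (f : T -> R) z, continuous f z ->
      continuous (U := C_R_NormedModule) (fun t => e (f t)) z).
    { intros T f z Hf; apply continuous_Cplus; [apply continuous_const|].
      apply continuous_Cmult; [apply continuous_RtoC, Hf | apply continuous_const]. }
    assert (Cw : forall (T : UniformSpace) (f g : T -> R) z, continuous f z -> continuous g z ->
      continuous (U := C_R_NormedModule) (fun t => w (f t) (g t)) z).
    { intros T f g z Hf Hg; apply continuous_Cplus; [apply continuous_const|].
      apply continuous_Cmult; [apply continuous_RtoC, Hg | apply Ce, Hf]. }
    (* With [h = powexp L s], the first two goals hold because both derivatives equal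
       [(d - p) * h + e x * h' * u * (d - p)]. *)
    refine (conj _ (conj _ (conj _ (conj _ _)))).
    + eapply is_derive_Ceq; [apply is_derive_Cmult; [exact De|];
        apply (is_derive_powexp L s (fun y => w y u) x _ Hw Dwx)|].
      unfold Dp; cbv beta; ring.
    + eapply is_derive_Ceq; [apply is_derive_Cmult;
        [apply is_derive_Cmult; [apply is_derive_RtoC_id | apply is_derive_Cconst]|];
        apply (is_derive_powexp L s (w x) u _ Hw Dwu)|].
      unfold Dp; cbv beta; ring.
    + assert (F1 : continuous (fun z : R * R => fst z) (x, u)) by apply continuous_fst.
      assert (F2 : continuous (fun z : R * R => snd z) (x, u)) by apply continuous_snd.
      assert (W := Cw _ _ _ _ F1 F2).
      assert (G : forall s', continuous (U := C_R_NormedModule)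
        (fun z : R * R => powexp L s' (w (fst z) (snd z))) (x, u)).
      { intros s'; apply continuous_powexp; [exact Hw | exact W]. }
      apply continuous_Cplus; [apply continuous_Cmult; [apply continuous_const | apply G]|].
      apply continuous_Cmult; [apply (Ce _ _ _ F1)|].
      apply continuous_Cmult.
      * apply continuous_Cplus; [|apply continuous_Copp];
          (apply continuous_Cmult; [apply continuous_const | apply G]).
      * apply continuous_Cmult; [apply (continuous_RtoC _ _ F2) | apply continuous_const].
    + apply continuous_Cmult; [apply continuous_const|].
      apply continuous_powexp; auto.
      apply (Cw _ (fun _ => x) (fun t => t)); [apply continuous_const | apply continuous_id].
    + apply continuous_Cmult; [apply continuous_const|].
      apply (continuous_powexp L s (fun y => w y u)); auto.
      apply (Cw _ (fun t => t) (fun _ => u)); [apply continuous_id | apply continuous_const].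
  - eapply is_RInt_ext, H0; intros u _; unfold w, e; cbv beta.
    replace (p + RtoC 0 * (d - p))%C with p by ring; reflexivity.
  - eapply is_RInt_ext, H1; intros u _; unfold w, e; cbv beta.
    replace (p + RtoC 1 * (d - p))%C with d by ring; reflexivity.
Qed.

Hypotheses (HLp : 0 < Re (L * p)) (HLd : 0 < Re (L * d)).

(** [J e A] is a contour integral along the direction [e], with [dw = e du]. Those for [d] and [p]
    differ by the integral over the outer side, which is of order [A * exp (- (mu / 2) * A)].
    Dividing by [p] goes back from [dw] to [du]. *)
Lemma is_RInt_gen_powexp_rotate (l : C) :
  is_RInt_gen (V := C_R_NormedModule) (fun u => powexp L s (c + RtoC u * d))
    (at_point 0) (Rbar_locally p_infty) l ->
  is_RInt_gen (V := C_R_NormedModule) (fun u => powexp L s (c + RtoC u * p))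
    (at_point 0) (Rbar_locally p_infty) (/ p * (d * l))%C.
Proof.
  intros Hl.
  set (J := fun e A => RInt (V := C_R_CompleteNormedModule)
    (fun u => e * powexp L s (c + RtoC u * e))%C 0 A : C).
  assert (HJ : forall e A, 0 < Re e -> 0 <= A ->
    is_RInt (V := C_R_NormedModule) (fun u => e * powexp L s (c + RtoC u * e))%C 0 A (J e A)).
  { intros e A He HA; apply (RInt_correct (V := C_R_CompleteNormedModule)).
    apply ex_RInt_C_continuous; auto; intros t Ht.
    apply continuous_Cmult; [apply continuous_const|apply continuous_powexp].
    - rewrite re_plus, re_scal_l; nra.
    - apply continuous_Cplus; [apply continuous_const|].
      apply continuous_Cmult; [apply continuous_RtoC, continuous_id | apply continuous_const]. }
  assert (Hd0 : filterlim (J d) (Rbar_locally p_infty)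
    (locally (T := C_R_NormedModule) (d * l)%C)).
  { apply (filterlim_RInt_gen_p_infty (V := C_R_CompleteNormedModule)).
    apply is_RInt_gen_Cmult; [apply at_point_filter | apply Rbar_locally_filter | exact Hl]. }
  set (mu := Rmin (Re (L * p)) (Re (L * d))).
  assert (Hmu : 0 < mu) by (apply Rmin_glb_lt; auto).
  destruct (powexp_decay L s c mu (Cmod p + Cmod d) Hc Hmu) as [K HK].
  assert (Hdiff : filterlim (fun A => J d A - J p A)%C (Rbar_locally p_infty)
    (locally (T := C_R_NormedModule) (RtoC 0))).
  { apply filterlim_C_0 with (fun A => Cmod (d - p) * K * A * exp (- (mu / 2) * A)).
    2:{ apply (is_lim_mult_exp_decay (Cmod (d - p) * K) (mu / 2)); lra. }
    exists 0; intros A HA.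
    assert (HR := is_RInt_powexp_rotate A _ _ (Rlt_le _ _ HA)
      (HJ p A Hp (Rlt_le _ _ HA)) (HJ d A Hd (Rlt_le _ _ HA))).
    rewrite <- norm_Cmod.
    (* [A * Cmod (d - p)] is the length of the outer side, parametrized by [0, 1]. *)
    replace (Cmod (d - p) * K * A * exp (- (mu / 2) * A))
      with ((1 - 0) * (A * Cmod (d - p) * (K * exp (- (mu / 2) * A)))) by ring.
    eapply (norm_RInt_le_const (V := C_R_NormedModule)); [lra| |exact HR].
    intros x Hx; rewrite norm_Cmod, !Cmod_mult, Cmod_R, Rabs_right by lra.
    apply Rmult_le_compat_l; [apply Rmult_le_pos; [lra|apply Cmod_ge_0]|].
    (* As a convex combination of [p] and [d], the direction inherits their bounds on [Re e],
       [Cmod e] and [Re (L * e)]. *)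
    replace (p + RtoC x * (d - p))%C with (RtoC (1 - x) * p + RtoC x * d)%C
      by (rewrite RtoC_minus; ring).
    apply HK; [lra| | |].
    - rewrite re_plus, !re_scal_l; nra.
    - eapply Rle_trans; [apply Cmod_triangle|].
      rewrite !Cmod_mult, !Cmod_R, !Rabs_right by lra.
      assert (P1 := Cmod_ge_0 p); assert (P2 := Cmod_ge_0 d); nra.
    - replace (L * (RtoC (1 - x) * p + RtoC x * d))%C
        with (RtoC (1 - x) * (L * p) + RtoC x * (L * d))%C by ring.
      rewrite re_plus, !re_scal_l.
      assert (mu <= Re (L * p)) by apply Rmin_l.
      assert (mu <= Re (L * d)) by apply Rmin_r.
      nra. }
  assert (Hp0 : p <> RtoC 0) by (apply Re_pos_neq_0; auto).
  assert (HI : is_RInt_gen (V := C_R_NormedModule)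
    (fun u => p * powexp L s (c + RtoC u * p))%C (at_point 0) (Rbar_locally p_infty) (d * l)%C).
  { apply is_RInt_gen_p_infty with (J p); [intros; apply HJ; auto|].
    replace (d * l)%C with (d * l + - 0)%C by ring.
    apply (filterlim_ext (fun A => J d A + - (J d A - J p A))%C); [intros; ring|].
    apply filterlim_Cplus; [exact Hd0 | apply filterlim_Copp, Hdiff]. }
  apply (is_RInt_gen_ext (V := C_R_NormedModule)
    (fun u => / p * (p * powexp L s (c + RtoC u * p)))%C); 
    [|apply is_RInt_gen_Cmult; [apply at_point_filter | apply Rbar_locally_filter | exact HI]].
  apply filter_forall; intros _ t _.
  rewrite Cmult_assoc, Cinv_l, Cmult_1_l; auto.
Qed.

End Rotation.

(** * Bernoulli polynomials *)

Lemma bernoulli_upto_le (n k : nat) : (k <= n)%nat -> bernoulli_upto n k = bernoulli k.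
Proof.
  induction n; intros Hk.
  - replace k with 0%nat by lia; reflexivity.
  - destruct (Nat.eq_dec k (S n)) as [->|]; [reflexivity|].
    simpl; rewrite (proj2 (Nat.leb_le k n)) by lia; apply IHn; lia.
Qed.

Lemma bernoulli_S (m : nat) :
  bernoulli (S m) = - / INR (m + 2) * sum_f_R0 (fun j => Binomial.C (m + 2) j * bernoulli j) m.
Proof.
  unfold bernoulli at 1; cbn [bernoulli_upto].
  rewrite (proj2 (Nat.leb_gt (S m) m)) by lia.
  f_equal; apply sum_eq; intros j Hj; rewrite bernoulli_upto_le by lia; reflexivity.
Qed.

Lemma bernoulli_poly_0 (n : nat) : bernoulli_poly n 0 = bernoulli n.
Proof.
  unfold bernoulli_poly; destruct n; [cbn; rewrite C_n_0; ring|].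
  rewrite tech5, Nat.sub_diag, C_n_n, (sum_eq _ (fun _ => 0)), sum_cte; [simpl; ring|].
  intros j Hj; rewrite pow_i by lia; ring.
Qed.

(** At 1 all powers are 1, and the recursion defining the Bernoulli number of index [n - 1] cancels
    every term but the last. For [n = 1] this fails: the values at 0 and 1 are -1/2 and 1/2. *)
Lemma bernoulli_poly_1 (n : nat) : (2 <= n)%nat -> bernoulli_poly n 1 = bernoulli n.
Proof.
  intros Hn; unfold bernoulli_poly.
  destruct n as [|[|m]]; try lia.
  rewrite (sum_eq _ (fun j => Binomial.C (S (S m)) j * bernoulli j))
    by (intros; rewrite pow1; ring).
  rewrite !tech5, C_n_n, (pascal_step1 (S (S m)) (S m)) by lia.
  replace (S (S m) - S m)%nat with 1%nat by lia.
  assert (H1 : Binomial.C (S (S m)) 1 = INR (m + 2)).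
  { rewrite (pascal_step3 (S (S m)) 0), C_n_0 by lia.
    replace (S (S m) - 0)%nat with (m + 2)%nat by lia; simpl; field. }
  rewrite H1, (bernoulli_S m).
  replace (S (S m)) with (m + 2)%nat by lia.
  field; apply not_0_INR; lia.
Qed.

Lemma is_derive_bernoulli_poly (n : nat) (x : R) :
  is_derive (bernoulli_poly (S n)) x (INR (S n) * bernoulli_poly n x).
Proof.
  assert (H : forall m, (m <= n)%nat ->
    is_derive (fun y => sum_f_R0 (fun j => Binomial.C (S n) j * bernoulli j * y ^ (S n - j)) m) x
      (INR (S n) * sum_f_R0 (fun j => Binomial.C n j * bernoulli j * x ^ (n - j)) m)).
  { assert (T : forall j, (j <= n)%nat ->
      is_derive (fun y => Binomial.C (S n) j * bernoulli j * y ^ (S n - j)) x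
        (INR (S n) * (Binomial.C n j * bernoulli j * x ^ (n - j)))).
    { intros j Hj; replace (S n - j)%nat with (S (n - j)) by lia.
      auto_derive; auto.
      rewrite pascal_step2 by lia.
      replace (S n - j)%nat with (S (n - j)) by lia.
      change (match (n - j)%nat with 0%nat => 1 | S _ => INR (n - j) + 1 end)
        with (INR (S (n - j))).
      field; apply not_0_INR; lia. }
    induction m; intros Hm; simpl.
    - apply T; lia.
    - rewrite Rmult_plus_distr_l.
      apply (is_derive_plus (V := R_NormedModule)); [apply IHm; lia | apply T; lia]. }
  apply (is_derive_ext (fun y => plus
    (sum_f_R0 (fun j => Binomial.C (S n) j * bernoulli j * y ^ (S n - j)) n)
    (Binomial.C (S n) (S n) * bernoulli (S n)))).
  { intros t; unfold bernoulli_poly; rewrite tech5, Nat.sub_diag; simpl; unfold plus; simpl; ring. }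
  replace (INR (S n) * bernoulli_poly n x) with (plus (INR (S n) * bernoulli_poly n x) zero)
    by apply Rplus_0_r.
  apply (is_derive_plus (V := R_NormedModule)); [apply (H n); lia|].
  apply (is_derive_const (V := R_NormedModule)).
Qed.

(** Its purpose is the vanishing of the odd Bernoulli numbers. The induction hypothesis gives the
    difference [g] of the two sides derivative 0. *)
Lemma bernoulli_poly_reflection (n : nat) (x : R) :
  bernoulli_poly n (1 - x) = (-1) ^ n * bernoulli_poly n x.
Proof.
  revert x; induction n; intros x.
  { unfold bernoulli_poly; cbn; ring. }
  assert (D : forall m t, is_derive (fun y => bernoulli_poly (S m) (1 - y)) t
    (- (INR (S m) * bernoulli_poly m (1 - t)))).
  { intros m t.
    evar_last; [apply (is_derive_comp (bernoulli_poly (S m)) (fun y => 1 - y));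
      [apply is_derive_bernoulli_poly | auto_derive; auto]|].
    unfold scal; simpl; unfold mult; simpl; ring. }
  set (g := fun y => bernoulli_poly (S n) (1 - y) - (-1) ^ S n * bernoulli_poly (S n) y).
  assert (Dg : forall t, is_derive g t zero).
  { intros t; unfold g.
    evar_last; [apply (is_derive_minus (V := R_NormedModule)); [apply D |
      apply (is_derive_scal (bernoulli_poly (S n))), is_derive_bernoulli_poly]|].
    rewrite IHn; unfold minus, plus, opp, zero; simpl; ring. }
  assert (Hg : forall y, g y = g 0).
  { intros y; destruct (Rtotal_order y 0) as [H|[->|H]]; auto.
    - apply (eq_is_derive (V := R_NormedModule) g y 0); auto.
    - symmetry; apply (eq_is_derive (V := R_NormedModule) g 0 y); auto. }
  (* [g] is constant, and a multiple of it has a primitive [h] with [h 0 = h 1],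
     because [B_(n+2)] takes the same value at [0] and [1]. *)
  set (h := fun y => - bernoulli_poly (S (S n)) (1 - y)
    - (-1) ^ S n * bernoulli_poly (S (S n)) y - INR (S (S n)) * g 0 * y).
  assert (Dh : forall t, is_derive h t zero).
  { intros t; unfold h.
    evar_last; [apply (is_derive_minus (V := R_NormedModule));
      [apply (is_derive_minus (V := R_NormedModule));
        [apply (is_derive_opp (V := R_NormedModule)), D |
         apply (is_derive_scal (bernoulli_poly (S (S n)))), is_derive_bernoulli_poly]
      | apply (is_derive_scal (fun y => y)), (is_derive_id (K := R_AbsRing))]|].
    rewrite <- (Hg t); unfold g, minus, plus, opp, zero, one; simpl; ring. }
  assert (Hh : h 0 = h 1) by (apply (eq_is_derive (V := R_NormedModule) h); auto; lra).
  unfold h in Hh; rewrite Rminus_0_r, Rminus_diag, bernoulli_poly_0, bernoulli_poly_1 in Hh by lia.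
  assert (HN : INR (S (S n)) <> 0) by (apply not_0_INR; lia).
  assert (H0 : g 0 = 0).
  { apply Rmult_eq_reg_l with (INR (S (S n))); auto; lra. }
  assert (Hx := Hg x); rewrite H0 in Hx; unfold g in Hx; lra.
Qed.

(** Reflection at 0 makes the values at 0 and 1 opposite, whereas they agree from index 2 on. *)
Lemma bernoulli_odd (k : nat) : (1 <= k)%nat -> bernoulli (2 * k + 1) = 0.
Proof.
  intros Hk.
  assert (H := bernoulli_poly_reflection (2 * k + 1) 0).
  rewrite Rminus_0_r, bernoulli_poly_0, bernoulli_poly_1, pow_add, pow_1_even in H by lia.
  lra.
Qed.

Lemma bernoulli_poly_bounded (n : nat) :
  exists K, forall x, 0 <= x <= 1 -> Rabs (bernoulli_poly n x) <= K.
Proof.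
  exists (sum_f_R0 (fun j => Rabs (Binomial.C n j * bernoulli j)) n); intros x Hx.
  unfold bernoulli_poly; eapply Rle_trans; [apply Rsum_abs|].
  apply sum_Rle; intros j Hj; rewrite Rabs_mult.
  assert (Hp : 0 <= x ^ (n - j)) by (apply pow_le; lra).
  assert (Hq : x ^ (n - j) <= 1 ^ (n - j)) by (apply pow_incr; lra).
  rewrite pow1 in Hq; rewrite (Rabs_right (x ^ _)) by lra.
  assert (Hb := Rabs_pos (Binomial.C n j * bernoulli j)); nra.
Qed.

(** * Euler-Maclaurin formula *)

Lemma frac_part_between (k : nat) (t : R) : INR k < t < INR k + 1 -> frac_part t = t - INR k.
Proof.
  intros H.
  destruct (Int_part_frac_part_spec t (Z.of_nat k) (t - INR k)) as [_ E]; auto.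
  - lra.
  - rewrite <- INR_IZR_INZ; ring.
Qed.

Lemma sum_lt_ext (f g : nat -> C) (n : nat) :
  (forall k, (k < n)%nat -> f k = g k) -> sum_lt f n = sum_lt g n.
Proof.
  induction n; intros H; simpl; auto.
  rewrite IHn, H; auto.
Qed.

Lemma sum_lt_add (f : nat -> C) (m n : nat) :
  sum_lt f (m + n) = (sum_lt f m + sum_lt (fun k => f (m + k)%nat) n)%C.
Proof.
  induction n; simpl.
  - rewrite Nat.add_0_r; ring.
  - rewrite Nat.add_succ_r; simpl; rewrite IHn; ring.
Qed.

Lemma sum_n_sum_lt (f : nat -> C) (n : nat) :
  sum_n (G := C_AbelianMonoid) f n = sum_lt f (S n).
Proof.
  induction n.
  - rewrite sum_O; simpl; ring.
  - rewrite sum_Sn, IHn; reflexivity.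
Qed.

(** In this normalization the derivative lowers the index without any factor, so repeated
    integration by parts produces no constants. *)
Definition scaled_bernoulli (m : nat) (x : R) : R := bernoulli_poly m x / INR (fact m).

Section EulerMaclaurin.

Variables (N : nat) (F : nat -> R -> C).
Hypothesis HF : forall i t, INR N <= t ->
  is_derive (V := C_R_NormedModule) (F i) t (F (S i) t).

Lemma continuous_euler_maclaurin (i : nat) (t : R) : INR N <= t ->
  continuous (U := C_R_NormedModule) (F i) t.
Proof. intros Ht; apply (ex_derive_continuous (V := C_R_NormedModule)); eexists; apply HF, Ht. Qed.

(** One integration by parts, [F i] being the derivative of order [i] of [F 0]. It is kept as the
    integral of the derivative of a product, so that successive instances can be added and
    subtracted and their integrands telescope. *)
Lemma is_RInt_bernoulli_by_parts (m k : nat) : (N <= k)%nat ->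
  is_RInt (V := C_R_NormedModule)
    (fun t => RtoC (scaled_bernoulli m (t - INR k)) * F m t
      + RtoC (scaled_bernoulli (S m) (t - INR k)) * F (S m) t)%C
    (INR k) (INR k + 1)
    (RtoC (scaled_bernoulli (S m) 1) * F m (INR k + 1)
      - RtoC (scaled_bernoulli (S m) 0) * F m (INR k))%C.
Proof.
  intros Hk; apply le_INR in Hk.
  assert (Db : forall t, is_derive (fun t => scaled_bernoulli (S m) (t - INR k)) t
    (scaled_bernoulli m (t - INR k))).
  { intros t.
    assert (D : is_derive (fun t => bernoulli_poly (S m) (t - INR k)) t
      (scal 1 (INR (S m) * bernoulli_poly m (t - INR k)))).
    { apply (is_derive_comp (bernoulli_poly (S m)) (fun t => t - INR k));
        [apply is_derive_bernoulli_poly | auto_derive; auto]. }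
    assert (D' := is_derive_scal _ t (/ INR (fact (S m))) _ D).
    replace (scaled_bernoulli m (t - INR k))
      with (/ INR (fact (S m)) * scal 1 (INR (S m) * bernoulli_poly m (t - INR k))).
    { eapply is_derive_ext; [|exact D']; intros y.
      unfold scaled_bernoulli, Rdiv; apply Rmult_comm. }
    unfold scaled_bernoulli; rewrite fact_simpl, mult_INR; change (scal 1 ?x) with (1 * x).
    field; split; [apply INR_fact_neq_0 | apply not_0_INR; lia]. }
  assert (Cb : forall j t, continuous (fun t => scaled_bernoulli j (t - INR k)) t).
  { intros [|j] t.
    (* Index 0, a constant, is apart because the derivative rule only concerns successors. *)
    - apply continuous_ext with (fun _ => 1); [|apply continuous_const].
      intros y; unfold scaled_bernoulli, bernoulli_poly; cbn; rewrite C_n_0; field.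
    - unfold scaled_bernoulli, Rdiv; apply (continuous_mult (K := R_AbsRing)); [|apply continuous_const].
      apply (continuous_comp (fun t => t - INR k) (bernoulli_poly (S j))).
      + apply (ex_derive_continuous (V := R_NormedModule)); auto_derive; auto.
      + apply (ex_derive_continuous (V := R_NormedModule)); eexists; apply is_derive_bernoulli_poly. }
  set (P := fun t => (RtoC (scaled_bernoulli (S m) (t - INR k)) * F m t)%C).
  replace (RtoC (scaled_bernoulli (S m) 1) * F m (INR k + 1)
    - RtoC (scaled_bernoulli (S m) 0) * F m (INR k))%C
    with (P (INR k + 1)%R - P (INR k))%C.
  2:{ unfold P; replace (INR k + 1 - INR k) with 1 by ring; rewrite Rminus_diag; reflexivity. }
  apply (is_RInt_derive (V := C_R_CompleteNormedModule) P); intros t Ht;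
    rewrite Rmin_left in Ht by lra.
  - apply (is_derive_Cmult (fun t => RtoC (scaled_bernoulli (S m) (t - INR k))) (F m));
      [apply (is_derive_RtoC (fun t => scaled_bernoulli (S m) (t - INR k))), Db | apply HF; lra].
  - assert (Ct : forall j, continuous (U := C_R_NormedModule)
      (fun t => RtoC (scaled_bernoulli j (t - INR k)) * F j t)%C t).
    { intros j; apply continuous_Cmult;
        [exact (continuous_RtoC _ _ (Cb j t)) | apply continuous_euler_maclaurin; lra]. }
    apply continuous_Cplus; apply Ct.
Qed.

Definition bernoulli_sum (M : nat) (t : R) : C :=
  sum_n_m (G := C_AbelianMonoid) (fun k : nat =>
    RtoC (bernoulli (2 * k) / INR (fact (2 * k))) * F (2 * k - 1) t)%C 1 M.

Lemma bernoulli_sum_S (M : nat) (t : R) :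
  bernoulli_sum (S M) t = (bernoulli_sum M t
    + RtoC (bernoulli (2 * S M) / INR (fact (2 * S M))) * F (2 * S M - 1) t)%C.
Proof. apply (sum_n_Sm (G := C_AbelianMonoid)); lia. Qed.

(** Base case: the instances 0 and 1 of the integration by parts are subtracted, which eliminates
    [F 1]; the halves are the values of the first Bernoulli polynomial at the ends. Each step in [M]
    adds the difference of two further instances, eliminating one even and one odd derivative. *)
Lemma is_RInt_euler_maclaurin_poly (M k : nat) : (1 <= M)%nat -> (N <= k)%nat ->
  is_RInt (V := C_R_NormedModule)
    (fun t => F 0 t - RtoC (scaled_bernoulli (2 * M) (t - INR k)) * F (2 * M) t)%C
    (INR k) (INR k + 1)
    (RtoC (/ 2) * (F 0 (INR k) + F 0 (INR k + 1))
      - (bernoulli_sum M (INR k + 1) - bernoulli_sum M (INR k)))%C.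
Proof.
  intros HM Hk.
  assert (b0 : forall x, scaled_bernoulli 0 x = 1).
  { intros x; unfold scaled_bernoulli, bernoulli_poly; cbn; rewrite C_n_0; field. }
  assert (B1 : bernoulli 1 = - / 2).
  { rewrite bernoulli_S; cbn; rewrite C_n_0; field. }
  assert (b1 : scaled_bernoulli 1 0 = - / 2 /\ scaled_bernoulli 1 1 = / 2).
  { unfold scaled_bernoulli, bernoulli_poly; cbn [sum_f_R0 fact]; rewrite C_n_0, C_n_n, B1.
    cbn; split; field. }
  assert (beq : forall j, scaled_bernoulli (S (S j)) 1 = scaled_bernoulli (S (S j)) 0).
  { intros j; unfold scaled_bernoulli; rewrite bernoulli_poly_0, bernoulli_poly_1 by lia; reflexivity. }
  assert (S1 := is_RInt_bernoulli_by_parts 0 k Hk).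
  induction M as [|M IH]; [lia|]; destruct M as [|M].
  - assert (S2 := is_RInt_bernoulli_by_parts 1 k Hk).
    assert (H := is_RInt_minus (V := C_R_NormedModule) _ _ _ _ _ _ S1 S2).
    match type of H with is_RInt _ _ _ ?v => match goal with |- is_RInt _ _ _ ?v' =>
      assert (Ev : v = v') end end.
    { rewrite bernoulli_sum_S, (bernoulli_sum_S 0).
      unfold bernoulli_sum; rewrite !sum_n_m_zero by lia.
      destruct b1 as [-> ->]; rewrite beq.
      replace (scaled_bernoulli 2 0) with (bernoulli 2 / INR (fact 2))
        by (unfold scaled_bernoulli; rewrite bernoulli_poly_0; reflexivity).
      change (minus ?x ?y) with (x - y)%C.
      change (@zero C_AbelianMonoid) with (RtoC 0).
      rewrite RtoC_opp; apply Ceq_minus; simpl (2 * 1)%nat; simpl (2 - 1)%nat; ring. }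
    rewrite <- Ev; eapply is_RInt_ext; [|exact H].
    intros t _; cbv beta; rewrite b0; change (minus ?x ?y) with (x - y)%C.
    apply Ceq_minus; simpl (2 * 1)%nat; ring.
  - assert (S2 := is_RInt_bernoulli_by_parts (2 * S M) k Hk).
    assert (S3 := is_RInt_bernoulli_by_parts (S (2 * S M)) k Hk).
    assert (H := is_RInt_plus (V := C_R_NormedModule) _ _ _ _ _ _ (IH ltac:(lia))
      (is_RInt_minus (V := C_R_NormedModule) _ _ _ _ _ _ S2 S3)).
    replace (2 * S (S M))%nat with (S (S (2 * S M))) in * by lia.
    match type of H with is_RInt _ _ _ ?v => match goal with |- is_RInt _ _ _ ?v' =>
      assert (Ev : v = v') end end.
    { rewrite !(bernoulli_sum_S (S M)).
      replace (2 * S (S M))%nat with (S (S (2 * S M))) by lia.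
      replace (2 * S M)%nat with (S (S (2 * M))) in * by lia.
      rewrite !beq.
      (* The boundary term of an even derivative carries an odd Bernoulli number, so only odd
         derivatives survive in [bernoulli_sum]. *)
      replace (scaled_bernoulli (S (S (S (2 * M)))) 0) with 0.
      2:{ unfold scaled_bernoulli; rewrite bernoulli_poly_0.
          replace (S (S (S (2 * M)))) with (2 * S M + 1)%nat by lia.
          rewrite bernoulli_odd by lia; unfold Rdiv; ring. }
      replace (scaled_bernoulli (S (S (S (S (2 * M))))) 0)
        with (bernoulli (S (S (S (S (2 * M))))) / INR (fact (S (S (S (S (2 * M)))))))
        by (unfold scaled_bernoulli; rewrite bernoulli_poly_0; reflexivity).
      replace (S (S (S (S (2 * M)))) - 1)%nat with (S (S (S (2 * M)))) by lia.
      change (minus ?x ?y) with (x - y)%C; change (plus ?x ?y) with (x + y)%C.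
      apply Ceq_minus; ring. }
    rewrite <- Ev; eapply is_RInt_ext; [|exact H].
    intros t _; cbv beta.
    change (minus ?x ?y) with (x - y)%C; change (plus ?x ?y) with (x + y)%C.
    apply Ceq_minus; ring.
Qed.

Definition euler_maclaurin_rem (M : nat) (t : R) : C :=
  (RtoC (periodic_bernoulli (2 * M) t / INR (fact (2 * M))) * F (2 * M) t)%C.

(** [F 0] and the remainder stay under one integral, whose value is known; integrability of the
    remainder alone is deduced from it afterwards. *)
Lemma is_RInt_euler_maclaurin (M n : nat) : (1 <= M)%nat ->
  is_RInt (V := C_R_NormedModule) (fun t => F 0 t - euler_maclaurin_rem M t)%C (INR N) (INR (N + n))
    (sum_lt (fun j => F 0 (INR (N + j))) n
      + RtoC (/ 2) * (F 0 (INR (N + n)) - F 0 (INR N))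
      - (bernoulli_sum M (INR (N + n)) - bernoulli_sum M (INR N)))%C.
Proof.
  intros HM; induction n.
  - rewrite Nat.add_0_r; simpl.
    replace (_ - _)%C with (RtoC 0) by ring.
    apply (is_RInt_point (V := C_R_NormedModule)).
  - assert (H := is_RInt_euler_maclaurin_poly M (N + n) HM (Nat.le_add_r N n)).
    rewrite Nat.add_succ_r, S_INR.
    match goal with |- is_RInt _ _ _ ?v' =>
      assert (Ev : (sum_lt (fun j => F 0 (INR (N + j))) n
      + RtoC (/ 2) * (F 0 (INR (N + n)) - F 0 (INR N))
      - (bernoulli_sum M (INR (N + n)) - bernoulli_sum M (INR N))
      + (RtoC (/ 2) * (F 0 (INR (N + n)) + F 0 (INR (N + n) + 1))
      - (bernoulli_sum M (INR (N + n) + 1) - bernoulli_sum M (INR (N + n)))))%C = v') end.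
    { simpl; set (x := F 0 (INR (N + n))).
      (* The node [N + n] receives one half from each of the two adjacent intervals. *)
      assert (Hx : x = (RtoC (/ 2) * x + RtoC (/ 2) * x)%C).
      { replace (RtoC (/ 2) * x + RtoC (/ 2) * x)%C with (RtoC (/ 2 + / 2) * x)%C
          by (rewrite RtoC_plus; ring).
        replace (/ 2 + / 2) with 1 by field; ring. }
      rewrite Hx at 3; ring. }
    rewrite <- Ev.
    apply (is_RInt_Chasles (V := C_R_NormedModule) _ _ (INR (N + n)) _ _ _ IHn).
    eapply is_RInt_ext; [|exact H].
    (* Agreement on the open interval suffices, so the jump of [frac_part] at the right end is
       harmless. *)
    intros t Ht; rewrite Rmin_left, Rmax_right in Ht by lra.
    unfold euler_maclaurin_rem, periodic_bernoulli.
    rewrite (frac_part_between (N + n) t Ht); reflexivity.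
Qed.

Variable lam : R.
Hypotheses (Hlam : 0 < lam) (Hdecay : forall i, exists K, forall t, INR N <= t ->
  Cmod (F i t) <= K * exp (- lam * t)).

Lemma ex_RInt_gen_F0 :
  ex_RInt_gen (V := C_R_NormedModule) (F 0) (at_point (INR N)) (Rbar_locally p_infty).
Proof.
  destruct (Hdecay 0) as [K HK].
  apply ex_RInt_gen_exp_decay with K lam; auto.
  intros b' Hb; apply ex_RInt_C_continuous; auto.
  intros t Ht; apply continuous_euler_maclaurin; lra.
Qed.

Lemma ex_RInt_gen_euler_maclaurin_rem (M : nat) : (1 <= M)%nat ->
  ex_RInt_gen (V := C_R_NormedModule) (euler_maclaurin_rem M) (at_point (INR N)) (Rbar_locally p_infty).
Proof.
  intros HM.
  destruct (Hdecay (2 * M)) as [K HK].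
  destruct (bernoulli_poly_bounded (2 * M)) as [Kb HKb].
  assert (Hf : 0 < INR (fact (2 * M))) by apply INR_fact_lt_0.
  apply ex_RInt_gen_exp_decay with (Kb / INR (fact (2 * M)) * K) lam; auto.
  - intros t Ht; unfold euler_maclaurin_rem; rewrite Cmod_mult, Cmod_R, Rmult_assoc.
    apply Rmult_le_compat; [apply Rabs_pos | apply Cmod_ge_0 | | apply HK, Ht].
    unfold Rdiv; rewrite Rabs_mult, (Rabs_right (/ _)) by (apply Rle_ge, Rlt_le, Rinv_0_lt_compat, Hf).
    apply Rmult_le_compat_r; [apply Rlt_le, Rinv_0_lt_compat, Hf|].
    apply HKb; assert (H := base_fp t); lra.
  - intros b' Hb.
    (* Up to an integer end the remainder is [F 0] minus the integrand of [is_RInt_euler_maclaurin],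
       both integrable; then restrict to [N, b']. *)
    destruct (INR_unbounded b') as [n Hn].
    apply (ex_RInt_Chasles_1 (V := C_R_CompleteNormedModule) _ _ _ (INR (N + n))).
    { rewrite plus_INR; assert (H := pos_INR N); lra. }
    assert (H1 : ex_RInt (V := C_R_NormedModule) (F 0) (INR N) (INR (N + n))).
    { apply ex_RInt_C_continuous; [apply le_INR; lia|].
      intros t Ht; apply continuous_euler_maclaurin; lra. }
    assert (H2 : ex_RInt (V := C_R_NormedModule)
      (fun t => F 0 t - euler_maclaurin_rem M t)%C (INR N) (INR (N + n)))
      by (eexists; apply is_RInt_euler_maclaurin, HM).
    eapply ex_RInt_ext; [|exact (ex_RInt_minus (V := C_R_NormedModule) _ _ _ _ H1 H2)].
    intros t _; change (minus ?x ?y) with (x - y)%C; apply Ceq_minus; ring.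
Qed.

Lemma filterlim_F_0 (i : nat) :
  filterlim (fun n => F i (INR (N + n))) eventually (locally (T := C_R_NormedModule) (RtoC 0)).
Proof.
  destruct (Hdecay i) as [K HK].
  apply filterlim_C_0 with (fun n => K * exp (- lam * INR (N + n))).
  - exists 0%nat; intros n _; apply HK, le_INR; lia.
  - apply (filterlim_comp _ _ _ (fun n => INR (N + n))
      (fun t => K * exp (- lam * t)) _ (Rbar_locally p_infty)).
    + intros P [B HB]; destruct (INR_unbounded B) as [n0 Hn0]; exists n0; intros n Hn.
      apply HB; eapply Rlt_le_trans; [exact Hn0|]; apply le_INR; lia.
    + apply (is_lim_exp_decay K lam Hlam).
Qed.

Lemma filterlim_bernoulli_sum_0 (M : nat) :
  filterlim (fun n => bernoulli_sum M (INR (N + n))) eventually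
    (locally (T := C_R_NormedModule) (RtoC 0)).
Proof.
  induction M.
  - apply filterlim_ext with (fun _ : nat => RtoC 0); [|apply filterlim_const].
    intros n; unfold bernoulli_sum; rewrite sum_n_m_zero by lia; reflexivity.
  - apply (filterlim_ext (fun n => bernoulli_sum M (INR (N + n))
      + RtoC (bernoulli (2 * S M) / INR (fact (2 * S M))) * F (2 * S M - 1) (INR (N + n)))%C).
    { intros n; rewrite bernoulli_sum_S; reflexivity. }
    set (c := RtoC (bernoulli (2 * S M) / INR (fact (2 * S M)))).
    replace (RtoC 0) with (0 + c * 0)%C by ring.
    apply filterlim_Cplus; [exact IHM|].
    eapply filterlim_comp; [apply filterlim_F_0|].
    apply (continuous_Cmult (T := C_R_NormedModule) (fun _ => c) (fun y => y)).
    + apply continuous_const.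
    + apply continuous_id.
Qed.

Theorem euler_maclaurin_p_infty (M : nat) (I0 I1 : C) : (1 <= M)%nat ->
  is_RInt_gen (V := C_R_NormedModule) (F 0) (at_point (INR N)) (Rbar_locally p_infty) I0 ->
  is_RInt_gen (V := C_R_NormedModule) (euler_maclaurin_rem M)
    (at_point (INR N)) (Rbar_locally p_infty) I1 ->
  filterlim (fun n => sum_lt (fun j => F 0 (INR (N + j))) n) eventually
    (locally (T := C_R_NormedModule)
      (I0 - I1 + RtoC (/ 2) * F 0 (INR N) - bernoulli_sum M (INR N))%C).
Proof.
  intros HM H0 H1.
  assert (HI : is_RInt_gen (V := C_R_NormedModule) (fun t => F 0 t - euler_maclaurin_rem M t)%C
    (at_point (INR N)) (Rbar_locally p_infty) (I0 - I1)%C)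
    by exact (is_RInt_gen_minus (V := C_R_NormedModule) _ _ _ _ H0 H1).
  assert (HL := filterlim_RInt_gen_p_infty (V := C_R_CompleteNormedModule) _ _ _ HI).
  assert (HN : filterlim (fun n => INR (N + n)) eventually (Rbar_locally p_infty)).
  { intros P [B HB]; destruct (INR_unbounded B) as [n0 Hn0]; exists n0; intros n Hn.
    apply HB; eapply Rlt_le_trans; [exact Hn0|]; apply le_INR; lia. }
  assert (HL' := filterlim_comp _ _ _ _ _ _ _ _ HN HL); cbv beta in HL'.
  (* The boundary terms, moved to the side of the integral; those at [N + n] tend to 0. *)
  set (g := fun n => (- (RtoC (/ 2) * (F 0 (INR (N + n)) + - F 0 (INR N)))
    + (bernoulli_sum M (INR (N + n)) + - bernoulli_sum M (INR N)))%C).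
  assert (Hg : filterlim g eventually (locally (T := C_R_NormedModule)
    (- (RtoC (/ 2) * (0 + - F 0 (INR N))) + (0 + - bernoulli_sum M (INR N)))%C)).
  { apply filterlim_Cplus.
    - apply filterlim_Copp.
      eapply filterlim_comp.
      + apply filterlim_Cplus; [apply filterlim_F_0 | apply filterlim_const].
      + apply (continuous_Cmult (T := C_R_NormedModule) (fun _ => RtoC (/ 2)) (fun y => y));
          [apply continuous_const | apply continuous_id].
    - apply filterlim_Cplus; [apply filterlim_bernoulli_sum_0 | apply filterlim_const]. }
  replace (I0 - I1 + RtoC (/ 2) * F 0 (INR N) - bernoulli_sum M (INR N))%C
    with (I0 - I1 + (- (RtoC (/ 2) * (0 + - F 0 (INR N))) + (0 + - bernoulli_sum M (INR N))))%C
    by ring.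
  eapply filterlim_ext; [|exact (filterlim_Cplus _ _ _ _ HL' Hg)].
  intros n; cbv beta.
  rewrite (is_RInt_unique (V := C_R_CompleteNormedModule) _ _ _ _ (is_RInt_euler_maclaurin M n HM)).
  unfold g; ring.
Qed.

End EulerMaclaurin.

(** * Derivatives of w^(-s) e^(-L w) and the Tricomi polynomials *)

(** The [n]-th derivative of [w^(-s) e^(-L w)] with respect to [w]. *)
Fixpoint powexp_deriv (L : C) (n : nat) (s w : C) : C :=
  match n with
  | O => powexp L s w
  | S m => - s * powexp_deriv L m (s + 1) w - L * powexp_deriv L m s w
  end%C.

(** [powexp_deriv] at [S m] applies the derivation of order [m] to the first derivative, so that it
    is also the derivative of order [m] differentiated once more needs an induction, with [s]
    free. *)
Lemma is_derive_powexp_deriv (L s : C) (n : nat) (w : R -> C) (x : R) (dw : C) :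
  0 < Re (w x) ->
  is_derive (V := C_R_NormedModule) w x dw ->
  is_derive (V := C_R_NormedModule) (fun t => powexp_deriv L n s (w t)) x
    (powexp_deriv L (S n) s (w x) * dw)%C.
Proof.
  intros Hp Hw; revert s; induction n; intros s.
  - apply is_derive_powexp; auto.
  - apply is_derive_Ceq with
      (- s * (powexp_deriv L (S n) (s + 1) (w x) * dw)
       + - (L) * (powexp_deriv L (S n) s (w x) * dw))%C.
    + apply (is_derive_ext (fun t => - s * powexp_deriv L n (s + 1) (w t)
        + - L * powexp_deriv L n s (w t))%C).
      { intros t; apply Ceq_minus; simpl powexp_deriv; ring. }
      apply is_derive_Cplus; apply is_derive_Cscal; apply IHn.
    + simpl powexp_deriv; ring.
Qed.

Lemma powexp_deriv_decay (L c : C) (n : nat) (s : C) : 0 < Re c -> 0 < Re L ->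
  exists K, forall u, 0 <= u ->
    Cmod (powexp_deriv L n s (c + RtoC u)) <= K * exp (- (Re L / 2) * u).
Proof.
  intros Hc HL; revert s; induction n; intros s.
  - destruct (powexp_decay L s c (Re L) 1 Hc HL) as [K HK].
    exists K; intros u Hu; simpl.
    rewrite <- (Cmult_1_r (RtoC u)); apply HK; auto.
    + simpl; lra.
    + rewrite Cmod_1; lra.
    + rewrite Cmult_1_r; lra.
  - destruct (IHn (s + 1)%C) as [K1 H1]; destruct (IHn s) as [K2 H2].
    exists (Cmod s * K1 + Cmod L * K2); intros u Hu.
    specialize (H1 u Hu); specialize (H2 u Hu).
    simpl powexp_deriv; unfold Cminus.
    eapply Rle_trans; [apply Cmod_triangle|].
    rewrite Cmod_opp, !Cmod_mult, Cmod_opp.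
    assert (P1 := Cmod_ge_0 s); assert (P2 := Cmod_ge_0 L); nra.
Qed.

(** [pochhammer] peels off its last factor, while the recursion in [s + 1] needs the first one. *)
Lemma pochhammer_S_shift (s : C) (j : nat) :
  pochhammer s (S j) = (s * pochhammer (s + 1) j)%C.
Proof.
  induction j.
  - simpl; ring.
  - change (pochhammer s (S (S j))) with (pochhammer s (S j) * (s + RtoC (INR (S j))))%C.
    rewrite IHj, S_INR, RtoC_plus; simpl; ring.
Qed.

Lemma sum_lt_plus (f g : nat -> C) (n : nat) :
  sum_lt (fun k => f k + g k)%C n = (sum_lt f n + sum_lt g n)%C.
Proof. induction n; simpl; [|rewrite IHn]; ring. Qed.

Lemma sum_lt_mult_l (c : C) (f : nat -> C) (n : nat) :
  sum_lt (fun k => c * f k)%C n = (c * sum_lt f n)%C.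
Proof. induction n; simpl; [|rewrite IHn]; ring. Qed.

Lemma tricomiU_neg_eq (n : nat) (s beta x : C) : beta = (1 - RtoC (INR n) - s)%C ->
  tricomiU_neg n beta x =
  sum_lt (fun j => RtoC (Binomial.C n j) * pochhammer s j * x ^ (n - j))%C (S n).
Proof.
  intros ->; unfold tricomiU_neg.
  replace (1 - RtoC (INR n) - (1 - RtoC (INR n) - s))%C with s by ring; reflexivity.
Qed.

(** By Pascal's rule each coefficient splits in two: one part releases [s] through
    [(s)_(j+1) = s (s+1)_j], the other releases a factor [x]. Up to signs this is the recursion of
    [powexp_deriv]. *)
Lemma tricomiU_neg_S (n : nat) (s x : C) :
  tricomiU_neg (S n) (1 - RtoC (INR (S n)) - s) x =
  (s * tricomiU_neg n (1 - RtoC (INR n) - (s + 1)) x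
   + x * tricomiU_neg n (1 - RtoC (INR n) - s) x)%C.
Proof.
  rewrite (tricomiU_neg_eq (S n) s), (tricomiU_neg_eq n (s + 1)), (tricomiU_neg_eq n s) by reflexivity.
  set (f := fun j => (RtoC (Binomial.C (S n) j) * pochhammer s j * x ^ (S n - j))%C).
  set (g := fun j => (RtoC (Binomial.C n j) * pochhammer (s + 1) j * x ^ (n - j))%C).
  set (h := fun j => (RtoC (Binomial.C n j) * pochhammer s j * x ^ (n - j))%C).
  (* Pascal's rule covers the inner terms only: the term [j = 0] belongs to the [x] part, the term
     [j = S n] to the [s] part. *)
  rewrite (sum_lt_add f 1 (S n) : sum_lt f (S (S n)) = _).
  rewrite (sum_lt_add h 1 n : sum_lt h (S n) = _).
  change (sum_lt (fun k => f (1 + k)%nat) (S n))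
    with (sum_lt (fun k => f (S k)) n + f (S n))%C.
  rewrite (sum_lt_ext (fun k => f (S k)) (fun j => s * g j + x * h (S j))%C n).
  2:{ intros j Hj; unfold f, g, h.
      rewrite <- pascal, RtoC_plus, pochhammer_S_shift by lia.
      replace (S n - S j)%nat with (S (n - S j)) by lia.
      replace (n - j)%nat with (S (n - S j)) by lia.
      rewrite Cpow_S; ring. }
  rewrite sum_lt_plus, !sum_lt_mult_l; simpl sum_lt.
  assert (E0 : f 0%nat = (x * h 0%nat)%C).
  { unfold f, h; rewrite !C_n_0, !Nat.sub_0_r, Cpow_S; ring. }
  assert (E1 : f (S n) = (s * g n)%C).
  { unfold f, g; rewrite !C_n_n, !Nat.sub_diag, pochhammer_S_shift; ring. }
  rewrite E0, E1; ring.
Qed.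

(** Both sides satisfy one recursion: the powers of [w] come from
    [powexp L (s + 1) w = powexp L s w / w] and [L = (L * w) / w], the sign from the two minus signs
    in [powexp_deriv]. *)
Lemma powexp_deriv_tricomiU (L s w : C) (n : nat) : w <> RtoC 0 ->
  powexp_deriv L n s w =
  (RtoC ((-1) ^ n) * powexp L s w / w ^ n * tricomiU_neg n (1 - RtoC (INR n) - s) (L * w))%C.
Proof.
  intros Hw; revert s; induction n; intros s.
  - rewrite (tricomiU_neg_eq 0 s) by reflexivity; simpl; rewrite C_n_0; field.
  - assert (E : powexp L (s + 1) w = (powexp L s w / w)%C).
    { unfold powexp, Cdiv; rewrite <- (Cexp_opp_Clog w Hw), <- Cexp_plus.
      f_equal; ring. }
    assert (Hn := Cpow_nz w n Hw).
    rewrite tricomiU_neg_S; simpl powexp_deriv; rewrite !IHn, E.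
    rewrite Cpow_S; change ((-1) ^ S n) with (-1 * (-1) ^ n); rewrite RtoC_mult.
    field; auto.
Qed.

(** * Change of variable in improper integrals, the incomplete Gamma function, and the Lerch
    expansion *)

Lemma is_RInt_gen_shift {V : NormedModule R_AbsRing} (f : R -> V) (a : R) (l : V) :
  is_RInt_gen f (at_point a) (Rbar_locally p_infty) l ->
  is_RInt_gen (fun u => f (a + u)) (at_point 0) (Rbar_locally p_infty) l.
Proof.
  intros H P HP; destruct (H P HP) as [Q S HQ HS Hi]; unfold filtermapi.
  apply Filter_prod with (fun x => x = 0) (fun b => S (a + b)).
  - reflexivity.
  - destruct HS as [B HB]; exists (B - a); intros x Hx; apply HB; lra.
  - intros x b -> Hb; destruct (Hi a (a + b) HQ Hb) as [y [Hy HPy]]; exists y; split; auto.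
    simpl in Hy |- *.
    apply (is_RInt_ext (fun u => scal 1 (f (1 * u + a)))).
    + intros u _; rewrite (scal_one (K := R_Ring)); f_equal; ring.
    + apply (is_RInt_comp_lin f 1 a 0 b).
      replace (1 * 0 + a) with a by ring; replace (1 * b + a) with (a + b) by ring; exact Hy.
Qed.

Lemma is_RInt_gen_ext_p_infty {V : NormedModule R_AbsRing} (f g : R -> V) (a : R) (l : V) :
  (forall t, a < t -> f t = g t) ->
  is_RInt_gen f (at_point a) (Rbar_locally p_infty) l ->
  is_RInt_gen g (at_point a) (Rbar_locally p_infty) l.
Proof.
  intros H; apply is_RInt_gen_ext.
  apply Filter_prod with (fun x => x = a) (fun b => a < b).
  - reflexivity.
  - exists a; auto.
  - intros x b -> Hb t; simpl; rewrite Rmin_left by lra; intros Ht; apply H, Ht.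
Qed.

Lemma Re_inv_pos (w : C) : 0 < Re w -> 0 < Re (/ w).
Proof.
  intros Hw; unfold Re in *; simpl; apply Rdiv_lt_0_compat; nra.
Qed.

Lemma Gamma_upper_powexp (L s c l : C) : 0 < Re L -> 0 < Re c ->
  is_RInt_gen (V := C_R_NormedModule) (fun u => powexp L s (c + RtoC u))
    (at_point 0) (Rbar_locally p_infty) l ->
  Gamma_upper (1 - s) (L * c) = (Cpower L (- s) * (L * l))%C.
Proof.
  intros HL Hc Hl.
  assert (HL0 := Re_pos_neq_0 L HL).
  unfold Gamma_upper; apply (is_RInt_gen_unique (V := C_R_CompleteNormedModule)).
  (* Rotation with [p = / L] and [d = 1]; decay holds along both since [L * p = 1] and
     [Re (L * d) = Re L > 0]. *)
  assert (HR : is_RInt_gen (V := C_R_NormedModule) (fun u => powexp L s (c + RtoC u * / L))%C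
    (at_point 0) (Rbar_locally p_infty) (/ / L * (1 * l))%C).
  { apply is_RInt_gen_powexp_rotate; auto.
    - apply Re_inv_pos, HL.
    - simpl; lra.
    - rewrite Cinv_r by auto; simpl; lra.
    - rewrite Cmult_1_r; auto.
    - apply (is_RInt_gen_ext_p_infty (fun u => powexp L s (c + RtoC u))); auto.
      intros t _; rewrite Cmult_1_r; reflexivity. }
  replace (L * l)%C with (/ / L * (1 * l))%C by (field; auto).
  apply (is_RInt_gen_ext_p_infty (V := C_R_NormedModule)
    (fun u => Cpower L (- s) * powexp L s (c + RtoC u * / L))%C).
  - intros t Ht.
    (* With [w = c + t / L], the Gamma integrand [(L w)^(-s) e^(-L w)] splits into [L^(-s)] and
       [powexp L s w]. *)
    replace (L * c + RtoC t)%C with (L * (c + RtoC t * / L))%C by (field; auto).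
    unfold Cpower, powexp.
    assert (Hw : 0 < Re (c + RtoC t * / L)).
    { rewrite re_plus, re_scal_l; assert (H := Re_inv_pos L HL); nra. }
    rewrite Clog_mult_Re_pos, <- !Cexp_plus by auto; f_equal; ring.
  - apply is_RInt_gen_Cmult; [apply at_point_filter | apply Rbar_locally_filter | exact HR].
Qed.

Theorem proposition2p1 :
  forall (z s a : C) (N M : nat),
    (0 < Cmod z < 1)%R ->
    (forall n : nat, a <> RtoC (- INR n)) ->
    (1 <= M)%nat ->
    (0 < Re a + INR N)%R ->
    let aN := (a + RtoC (INR N))%C in
    let S_ := sum_lt (fun k => (z ^ k / Cpower (RtoC (INR k) + a) s)%C) N in
    let I_ := (Cpower (- Clog z) (s - 1) / Cpower z a
              * Gamma_upper (1 - s) (- (aN * Clog z)))%C in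
    let T_ :=
      (z ^ N / Cpower aN s
       * (1 / 2
          + sum_n_m (G := C_AbelianMonoid) (fun k : nat =>
              RtoC (bernoulli (2 * k) / INR (fact (2 * k)))
              * (tricomiU_neg (2 * k - 1) (- RtoC (INR (2 * k)) + 2 - s)
                   (- (aN * Clog z))
                 / aN ^ (2 * k - 1))) 1 M))%C in
    let integrand := fun t : R =>
      (RtoC (periodic_bernoulli (2 * M) t / INR (fact (2 * M)))
       * (Cpower z (RtoC t) / Cpower (a + RtoC t) (s + RtoC (INR (2 * M))))
       * tricomiU_neg (2 * M) (- RtoC (INR (2 * M)) + 1 - s)
           (- ((a + RtoC t) * Clog z)))%C in
    let R_ := (- RInt_gen (V := C_R_CompleteNormedModule) integrand
                  (at_point (INR N)) (Rbar_locally p_infty))%C in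
    ex_RInt_gen (V := C_R_NormedModule) integrand
      (at_point (INR N)) (Rbar_locally p_infty) /\
    lerch_phi z s a = (S_ + I_ + T_ + R_)%C.
Proof.
  intros z s a N M Hz _ HM Ha aN S_ I_ T_ integrand R_.
  set (L := (- Clog z)%C).
  assert (HzL : Clog z = (- L)%C) by (unfold L; ring).
  assert (HL : 0 < Re L).
  { unfold L; simpl; rewrite <- Ropp_0; apply Ropp_lt_contravar.
    rewrite <- ln_1; apply ln_increasing; lra. }
  assert (Hz0 : z <> RtoC 0) by (apply Cmod_gt_0; lra).
  assert (HaN : 0 < Re aN) by (unfold aN; rewrite re_plus, re_RtoC; lra).
  assert (Hw : forall t, INR N <= t -> 0 < Re (a + RtoC t))
    by (intros; rewrite re_plus, re_RtoC; lra).
  (* The factor [Cexp (a * L)], which is [z^(-a)], turns [e^(-L (a + t))] into [z^t]. *)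
  set (F := fun (i : nat) (t : R) => (Cexp (a * L) * powexp_deriv L i s (a + RtoC t))%C).
  assert (HF : forall i t, INR N <= t ->
    is_derive (V := C_R_NormedModule) (F i) t (F (S i) t)).
  { intros i t Ht; unfold F.
    apply is_derive_Cscal.
    apply is_derive_Ceq with (powexp_deriv L (S i) s (a + RtoC t) * (0 + 1))%C; [|ring].
    apply (is_derive_powexp_deriv L s i (fun t => a + RtoC t)%C); [apply Hw, Ht|].
    apply is_derive_Cplus; [apply is_derive_Cconst | apply is_derive_RtoC_id]. }
  assert (Hdecay : forall i, exists K, forall t, INR N <= t ->
    Cmod (F i t) <= K * exp (- (Re L / 2) * t)).
  { intros i; destruct (powexp_deriv_decay L aN i s HaN HL) as [K HK].
    (* The last factor converts decay in [t - INR N] into decay in [t]. *)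
    exists (Cmod (Cexp (a * L)) * K * exp (Re L / 2 * INR N)); intros t Ht.
    unfold F; rewrite Cmod_mult, !Rmult_assoc, <- exp_plus.
    apply Rmult_le_compat_l; [apply Cmod_ge_0|].
    replace (a + RtoC t)%C with (aN + RtoC (t - INR N))%C
      by (unfold aN; rewrite RtoC_minus; ring).
    replace (Re L / 2 * INR N + - (Re L / 2) * t) with (- (Re L / 2) * (t - INR N)) by ring.
    apply HK; lra. }
  assert (Hlam : 0 < Re L / 2) by lra.
  assert (HFn : forall n t, INR N <= t -> F n t =
    (RtoC ((-1) ^ n) * (Cpower z (RtoC t) / Cpower (a + RtoC t) s) / (a + RtoC t) ^ n
     * tricomiU_neg n (1 - RtoC (INR n) - s) (- ((a + RtoC t) * Clog z)))%C).
  { intros n t Ht; assert (Hwt := Re_pos_neq_0 _ (Hw t Ht)).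
    unfold F; rewrite powexp_deriv_tricomiU, HzL by auto.
    replace (- ((a + RtoC t) * - L))%C with (L * (a + RtoC t))%C by ring.
    unfold Cpower, powexp, Cdiv; rewrite HzL, <- (Cexp_opp (s * _)).
    rewrite <- (Cexp_plus (RtoC t * _)).
    replace (RtoC t * - L + - (s * Clog (a + RtoC t)))%C
      with (a * L + (- (s * Clog (a + RtoC t)) - L * (a + RtoC t)))%C by ring.
    rewrite Cexp_plus; ring. }
  assert (HF0 : forall t, INR N <= t -> F 0%nat t = (Cpower z (RtoC t) / Cpower (a + RtoC t) s)%C).
  { intros t Ht; rewrite HFn, (tricomiU_neg_eq 0 s) by (auto; reflexivity).
    simpl; rewrite C_n_0; field; apply Cexp_neq_0. }
  assert (Hpow : forall k, Cpower z (RtoC (INR k)) = (z ^ k)%C).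
  { intros k; unfold Cpower; rewrite Cexp_mult_nat, Cexp_Clog; auto. }
  destruct (ex_RInt_gen_F0 N F HF (Re L / 2) Hlam Hdecay) as [I0 HI0].
  destruct (ex_RInt_gen_euler_maclaurin_rem N F HF (Re L / 2) Hlam Hdecay M HM) as [I1 HI1].
  assert (HR : is_RInt_gen (V := C_R_NormedModule) integrand
    (at_point (INR N)) (Rbar_locally p_infty) I1).
  { revert HI1; apply is_RInt_gen_ext_p_infty; intros t Ht.
    assert (Hwt := Re_pos_neq_0 _ (Hw t (Rlt_le _ _ Ht))).
    unfold euler_maclaurin_rem, integrand; rewrite HFn, pow_1_even by lra.
    replace (- RtoC (INR (2 * M)) + 1 - s)%C with (1 - RtoC (INR (2 * M)) - s)%C by ring.
    (* A natural exponent can be split off: [Cexp] of [n] times the logarithm is an ordinary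
       power. *)
    replace (Cpower (a + RtoC t) (s + RtoC (INR (2 * M))))
      with (Cpower (a + RtoC t) s * (a + RtoC t) ^ (2 * M))%C.
    2:{ unfold Cpower; rewrite Cmult_plus_distr_r, Cexp_plus, Cexp_mult_nat, Cexp_Clog; auto. }
    assert (Hn := Cpow_nz _ (2 * M) Hwt).
    assert (Hc : Cpower (a + RtoC t) s <> RtoC 0) by apply Cexp_neq_0.
    apply Ceq_minus; field; auto. }
  split; [exists I1; exact HR|].
  assert (ER : R_ = (- I1)%C).
  { unfold R_; rewrite (is_RInt_gen_unique (V := C_R_CompleteNormedModule) _ _ HR); reflexivity. }
  assert (EI : I_ = I0).
  { assert (HI : is_RInt_gen (V := C_R_NormedModule) (fun u => powexp L s (aN + RtoC u))
      (at_point 0) (Rbar_locally p_infty) (/ Cexp (a * L) * I0)%C).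
    { assert (H := is_RInt_gen_shift _ _ _ HI0).
      apply (is_RInt_gen_Cmult (/ Cexp (a * L))) in H.
      2: apply at_point_filter. 2: apply Rbar_locally_filter.
      revert H; apply is_RInt_gen_ext_p_infty; intros u _; unfold F, aN; simpl powexp_deriv.
      rewrite Cmult_assoc, Cinv_l, Cmult_1_l by apply Cexp_neq_0.
      f_equal; rewrite RtoC_plus; ring. }
    unfold I_.
    replace (- (aN * Clog z))%C with (L * aN)%C by (rewrite HzL; ring).
    rewrite (Gamma_upper_powexp L s aN _ HL HaN HI).
    fold L; unfold Cpower; rewrite HzL.
    replace (a * - L)%C with (- (a * L))%C by ring.
    (* [L^(s-1)] is written as [L^s / L], to cancel against the factors [L^(-s)] and [L] of
       [Gamma_upper_powexp]. *)
    replace ((s - 1) * Clog L)%C with (- - (s * Clog L) + - Clog L)%C by ring.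
    replace (- s * Clog L)%C with (- (s * Clog L))%C by ring.
    rewrite Cexp_plus, !Cexp_opp, Cexp_Clog by (apply Re_pos_neq_0; auto).
    field; repeat split; try apply Cexp_neq_0; apply Re_pos_neq_0; auto. }
  assert (ET : T_ = (RtoC (/ 2) * F 0%nat (INR N) - bernoulli_sum F M (INR N))%C).
  { unfold T_; rewrite <- Hpow, Cmult_plus_distr_l.
    rewrite HF0 by lra; fold aN.
    set (q := (Cpower z (RtoC (INR N)) / Cpower aN s)%C).
    assert (E2 : (q * (1 / 2) = RtoC (/ 2) * q)%C).
    { rewrite RtoC_inv by lra; unfold Cdiv; ring. }
    rewrite E2; apply (f_equal (Cplus (RtoC (/ 2) * q))).
    assert (Haz := Re_pos_neq_0 _ HaN).
    (* The induction on [M] starts at the empty sum, so the facts about [M >= 1] and the remainder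
       must go. *)
    clear - HFn Haz.
    induction M as [|m IH].
    - unfold bernoulli_sum; rewrite !sum_n_m_zero by lia.
      change (@zero C_AbelianMonoid) with (RtoC 0); ring.
    - rewrite bernoulli_sum_S, sum_n_Sm by lia.
      change (plus ?x ?y) with (x + y)%C.
      rewrite Cmult_plus_distr_l, IH, HFn by lra; fold aN q.
      (* The odd derivatives have sign -1, which turns the subtracted [bernoulli_sum] into the added
         sum in T. *)
      replace ((-1) ^ (2 * S m - 1)) with (-1).
      2:{ replace (2 * S m - 1)%nat with (S (2 * m)) by lia; rewrite pow_1_odd; reflexivity. }
      replace (1 - RtoC (INR (2 * S m - 1)) - s)%C with (- RtoC (INR (2 * S m)) + 2 - s)%C.
      2:{ rewrite minus_INR, RtoC_minus by lia; simpl (INR 1); ring. }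
      field; apply Cpow_nz, Haz. }
  rewrite ER, EI, ET.
  assert (HE := euler_maclaurin_p_infty N F HF (Re L / 2) Hlam Hdecay M I0 I1 HM HI0 HI1).
  set (u := fun k : nat => (z ^ k / Cpower (RtoC (INR k) + a) s)%C).
  assert (Hser : is_series (V := C_R_NormedModule) u
    (S_ + I0 + (RtoC (/ 2) * F 0%nat (INR N) - bernoulli_sum F M (INR N)) + - I1)%C).
  { assert (Hs : filterlim (fun n => S n - N)%nat eventually eventually).
    { intros P [n0 Hn0]; exists (n0 + N)%nat; intros n Hn; apply Hn0; lia. }
    assert (HE' := filterlim_comp _ _ _ _ _ _ _ _ Hs HE); cbv beta in HE'.
    assert (HE'' := filterlim_Cplus _ _ _ _
      (filterlim_const (F := eventually) (S_ : C_R_NormedModule)) HE').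
    replace (S_ + I0 + (RtoC (/ 2) * F 0%nat (INR N) - bernoulli_sum F M (INR N)) + - I1)%C
      with (S_ + (I0 - I1 + RtoC (/ 2) * F 0%nat (INR N) - bernoulli_sum F M (INR N)))%C by ring.
    eapply filterlim_ext_loc; [|exact HE''].
    exists N; intros n Hn; symmetry.
    change (sum_n (G := C_AbelianMonoid) u n
      = (S_ + sum_lt (fun j => F 0%nat (INR (N + j))) (S n - N))%C).
    rewrite sum_n_sum_lt.
    replace (S n) with (N + (S n - N))%nat at 1 by lia.
    rewrite sum_lt_add; f_equal.
    apply sum_lt_ext; intros k _; unfold u.
    rewrite HF0, Hpow by (apply le_INR; lia).
    rewrite (Cplus_comm a); reflexivity. }
  (* [iota] returns the sum of the series because that sum exists and is unique. *)
  unfold lerch_phi; apply (iota_unique (V := C_R_CompleteNormedModule)); [|exact Hser].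
  intros y Hy.
  apply (filterlim_locally_unique (V := C_R_NormedModule) (F := eventually) _ y _ Hy Hser).
Qed.
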